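(* Let $\mathbb{F}=\mathbb{C}$ or $\mathbb{F}=\mathbb{R}$, and let $f(x)=Ax+b$ and $g(x)=Cx+d$ be affine operators on $\mathbb{F}^n$, where $A,C\in\mathbb{F}^{n\times n}$ and $b,d\in\mathbb{F}^n$. Let $A_*,C_*$ be nonsingular parts and $A_0,C_0$ nilpotent parts of $A$ and $C$, i.e. $A$ is similar over $\mathbb F$ to $A_*\oplus A_0$ and $C$ is similar over $\mathbb F$ to $C_*\oplus C_0$, with $A_*,C_*$ nonsingular and $A_0,C_0$ nilpotent matrices over $\mathbb F$. (1) Suppose that $f$ and $g$ have fixed points. Then $f$ and $g$ are topologically conjugate if and only if the linear operators $x\mapsto Ax$ and $x\mapsto Cx$ are topologically conjugate. (2) Suppose that $f$ has a fixed point and $g$ has no fixed point. Then $f$ and $g$ are not topologically conjugate. (3) Suppose that $f$ and $g$ have no fixed points. (3a) If $\mathbb{F}=\mathbb{C}$, then $f$ and $g$ are topologically conjugate if and only if $A_0$ is similar to $C_0$. (3b) If $\mathbb{F}=\mathbb{R}$, then $f$ and $g$ are topologically conjugate if and only if the determinants of $A_*$ and $C_*$ have the same sign (i.e., $\det(A_* )\det(C_* )>0$) and $A_0$ is similar to $C_0$.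
   Context: An affine operator on $\mathbb{F}^n$ is a map $f:\mathbb{F}^n\to\mathbb{F}^n$ of the form $f(x)=Ax+b$ with $A\in\mathbb{F}^{n\times n}$, $b\in\mathbb{F}^n$. A point $p$ is a fixed point of $f$ if $f(p)=p$. Two maps $f,g:\mathbb{F}^n\to\mathbb{F}^n$ are topologically conjugate if $g=h^{-1}fh$ (composition) for some homeomorphism $h:\mathbb{F}^n\to\mathbb{F}^n$ (with the usual topology; $h$ need not be linear). Square matrices $M,N$ over $\mathbb F$ of the same size are similar if $S^{-1}MS=N$ for some nonsingular $S$ over $\mathbb F$; matrices of different sizes are not similar. Every square matrix $A$ over $\mathbb{F}$ is similar to a direct sum (block diagonal matrix) $A_*\oplus A_0$ with $A_*$ nonsingular and $A_0$ nilpotent, and these are unique up to similarity; either summand may be absent (of size $0\times 0$), two absent matrices being regarded as similar, and the determinant of an absent matrix being $1$. *)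

(* Defs.v *)
From HB Require Import structures.
From mathcomp Require Import all_boot all_order all_algebra.
From mathcomp Require Import all_classical all_reals all_analysis.
From mathcomp Require Export complex.

Set Implicit Arguments.
Unset Strict Implicit.
Unset Printing Implicit Defensive.

Import Order.TTheory GRing.Theory Num.Theory.
Import numFieldNormedType.Exports.
Local Open Scope ring_scope.

Definition affine (K : numFieldType) (n : nat) (A : 'M[K]_n) (b : 'cV[K]_n) :
  'cV[K]_n -> 'cV[K]_n := fun x => A *m x + b.

Definition has_fixed_point (T : Type) (f : T -> T) : Prop :=
  exists p, f p = p.

(* [hinv] is the inverse of the homeomorphism [h]. *)
Definition topologically_conjugate (T : topologicalType) (f g : T -> T) : Prop :=
  exists h hinv : T -> T,
    [/\ continuous h, continuous hinv, cancel h hinv, cancel hinv h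
      & g =1 hinv \o f \o h].

(* Heterogeneous in the sizes: matrices of different sizes are not similar, and
   any two 0 x 0 matrices are. *)
Definition similar_mx (K : fieldType) (m n : nat) (M : 'M[K]_m) (N : 'M[K]_n) :
  Prop :=
  exists (e : m = n) (S : 'M[K]_n),
    S \in unitmx /\ invmx S *m castmx (e, e) M *m S = N.

Definition nilpotent_mx (K : fieldType) (n : nat) (M : 'M[K]_n) : Prop :=
  exists k : nat, M ^+ k = 0.

(* [As] (+) [A0] is a decomposition of [A] into a nonsingular and a nilpotent
   part; similarity forces p + q = n, and p = 0 or q = 0 means that the
   corresponding part is absent. *)
Definition nonsingular_nilpotent_parts (K : fieldType) (n p q : nat)
    (A : 'M[K]_n) (As : 'M[K]_p) (A0 : 'M[K]_q) : Prop :=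
  [/\ As \in unitmx, nilpotent_mx A0 & similar_mx A (block_mx As 0 0 A0)].

(* Main.v *)
Require Import Defs.
From HB Require Import structures.
From mathcomp Require Import all_boot all_order all_algebra.
From mathcomp Require Import all_classical all_reals all_analysis.
From mathcomp Require Import ring lra.
Import Order.TTheory GRing.Theory Num.Theory.
Import numFieldNormedType.Exports.
Local Open Scope ring_scope.
Set Implicit Arguments.
Unset Strict Implicit.
Unset Printing Implicit Defensive.

(** Why the theorem holds.

Translating by fixed points reduces (1) to linear maps, and (2) holds because a
conjugacy transports fixed points. For (3), an affine map without fixed points
splits, by linear changes of coordinates and a translation, as the product of
an invertible affine map without fixed points (with matrix As) and the linear
nilpotent map A0.

Sufficiency. If f(x) = A x + b has no fixed point, some linear functional w
satisfies w A = w and w b = 1, so w(f(x)) = w(x) + 1, and f becomes a shear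
(t, y) |-> (t + 1, B y + t c + d) with det B = det A. Two such maps are
conjugate as soon as a homeomorphism intertwines them on the slice Re t = 0: it
extends from the fundamental domain 0 <= Re t <= 1 by applying the maps
([conjugate_fundamental_domain]). Such a homeomorphism is read off a path of
invertible matrices from 1 to B B'^-1, and Gauss elimination reduces the path to
a path of scalars ending at the determinant ([det_matrix_path]). Over the complex
numbers every nonzero scalar is reachable, over the reals every positive one.

Necessity, nilpotent part. A conjugacy maps the image of f^k onto the image of
g^k; these are affine subspaces, so by invariance of dimension A^k and C^k have
equal rank ([conjugate_pow_rank]). These ranks determine the size of As, the
ranks of the powers of A0, and hence the similarity class of A0
([nilpotent_similar]).

Necessity, sign. The conjugacy restricts to one between the invertible parts. If
their determinants had opposite signs, the sufficiency part would yield a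
homeomorphism h with h(E x + e) = h(x) + e, where e is the first basis vector and
E the reflection of the last coordinate. Then F_s(v) = h(s e + v) - h(s e - v) is
an odd family of nonvanishing maps, with F_(s+1)(E v) = F_s(v)
([not_conjugate_reflection]).

Both topological inputs, invariance of dimension and the impossibility of such a
family, come from one argument modulo 2, in the spirit of Tucker and Ky Fan.
Cochains are functions from finite sequences of points to the booleans. From an
odd family of m real functions without common zero one builds a cochain eta,
zero on sequences of more than m points, such that
  d eta = eta + eta o (antipode) + (indicator of one-point sequences)
on all simplices of a cross-polytope and of its product with an interval
([cylinder_antipodal_cochain]). Summing over hemispheres, the value of eta on
each sphere is 1 ([sphere_parity]); when m is too small this is absurd, which is
Borsuk-Ulam ([borsuk_ulam]). With the additional symmetry F_(s+1)(E v) = F_s(v),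
the prism homotopy formula forces the value on the top sphere to be 0
([no_twist]). *)

(** * Cochains modulo 2 and alternating cochains *)

Section Wedge.
Variable T : eqType.
Implicit Types (a b : T -> bool) (w : seq T -> bool) (s : seq T).

(** The exterior product of a 0-cochain with a cochain: modulo 2, the sum over
    the entries x of s of a(x) times the value of w on s with x deleted. *)
Fixpoint wedge a w s : bool :=
  if s is x :: s' then (a x && w s') (+) wedge a (w \o cons x) s' else false.

(** Modulo 2, and with the empty sequence as the only (-1)-simplex, the simplicial
    coboundary is the product with the constant 0-cochain 1. *)
Definition coboundary : (seq T -> bool) -> seq T -> bool := wedge xpredT.

Lemma eq_in_wedge a w w' s :
    (forall t, size s = (size t).+1 -> {subset t <= s} -> w t = w' t) ->
  wedge a w s = wedge a w' s.
Proof.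
elim: s w w' => //= x s IH w w' eqw; congr (_ && _ (+) _).
  by apply: eqw => // y ys; rewrite inE ys orbT.
apply: IH => t sz_t ts; apply: eqw => /=; first by rewrite sz_t.
by move=> y; rewrite !inE => /orP[->//|/ts ->]; rewrite orbT.
Qed.

Lemma wedgeD a w w' s :
  wedge a (fun t => w t (+) w' t) s = wedge a w s (+) wedge a w' s.
Proof.
elim: s w w' => //= x s IH w w'; rewrite (IH (w \o cons x) (w' \o cons x)).
by case: (a x); case: (w s); case: (w' s); case: (wedge _ _ s);
  case: (wedge _ _ s).
Qed.

Lemma wedge0 a s : wedge a (fun=> false) s = false.
Proof. by elim: s => //= x s ->; rewrite andbF. Qed.

Lemma wedgeDl a b w s :
  wedge (fun x => a x (+) b x) w s = wedge a w s (+) wedge b w s.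
Proof.
elim: s w => //= x s IH w; rewrite IH.
by case: (a x); case: (b x); case: (w s); case: (wedge a _ s);
  case: (wedge b _ s).
Qed.

Lemma eq_in_wedgel a b w s : {in s, a =1 b} -> wedge a w s = wedge b w s.
Proof.
elim: s w => //= x s IH w eqab; rewrite eqab ?mem_head// IH// => y ys.
by apply: eqab; rewrite inE ys orbT.
Qed.

Lemma wedge_false w s : wedge (fun=> false) w s = false.
Proof. by elim: s w => //= x s IH w; rewrite IH. Qed.

Lemma wedgeC a b w s : wedge a (wedge b w) s = wedge b (wedge a w) s.
Proof.
elim: s w => //= x s IH w.
have E c e : wedge c (wedge e w \o cons x) s =
    (e x && wedge c w s) (+) wedge c (wedge e (w \o cons x)) s.
  rewrite (@eq_in_wedge _ _
    (fun t => (e x && w t) (+) wedge e (w \o cons x) t))//.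
  rewrite (wedgeD c (fun t => e x && w t)); congr (_ (+) _).
  by case: (e x) => //=; rewrite wedge0.
rewrite !E IH; case: (a x); case: (b x) => /=; case: (wedge a w s);
  by case: (wedge b w s); case: (wedge b _ s).
Qed.

Lemma wedge_cons a b w x s : wedge a (wedge b w \o cons x) s =
  (b x && wedge a w s) (+) wedge a (wedge b (w \o cons x)) s.
Proof.
rewrite (@eq_in_wedge _ _
  (fun t => (b x && w t) (+) wedge b (w \o cons x) t))//.
rewrite (wedgeD a (fun t => b x && w t)); congr (_ (+) _).
by case: (b x) => //=; rewrite wedge0.
Qed.

Lemma wedge_id a w s : wedge a (wedge a w) s = false.
Proof. by elim: s w => //= x s IH w; rewrite wedge_cons IH addbF addbb. Qed.

(** Each term of the product picks an entry where a holds and another one where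
    b holds. *)
Lemma wedge_disjoint a b w s :
    (forall x y, x \in s -> y \in s -> a x -> b y -> false) ->
  wedge a (wedge b w) s = false.
Proof.
elim: s w => //= x s IH w ab; rewrite wedge_cons IH ?addbF; last first.
  by move=> y z ys zs; apply: ab; rewrite inE ?ys ?zs orbT.
case ax: (a x) => /=.
  rewrite (eq_in_wedgel (b := fun=> false)) ?wedge_false; last first.
    move=> y ys; apply/negbTE/negP => by_.
    by have := ab x y (mem_head _ _) _ ax by_; rewrite inE ys orbT => /(_ isT).
  case bx: (b x) => //=; have := ab x x (mem_head _ _) (mem_head _ _) ax bx.
  by [].
case bx: (b x) => //=.
rewrite (eq_in_wedgel (b := fun=> false)) ?wedge_false// => y ys.
apply/negbTE/negP => ay.
by have := ab y x _ (mem_head _ _) ay bx; rewrite inE ys orbT => /(_ isT).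
Qed.

Lemma coboundary_cons w x s :
  coboundary w (x :: s) = w s (+) coboundary (w \o cons x) s.
Proof. by []. Qed.

End Wedge.

Lemma wedge_map (T U : eqType) (f : T -> U) (a : U -> bool) w s :
  wedge a w (map f s) = wedge (a \o f) (w \o map f) s.
Proof. by elim: s w => //= x s IH w; rewrite IH. Qed.

Lemma coboundary_map (T U : eqType) (f : T -> U) (w : seq U -> bool) s :
  coboundary w (map f s) = coboundary (w \o map f) s.
Proof. exact: wedge_map. Qed.

Section Alternating.
Variable T : eqType.
Implicit Types (L : seq ((T -> bool) * (T -> bool))) (s : seq T).

(** A pair of 0-cochains is the positive and the negative side of one label. *)
Definition side (sgn : bool) (l : (T -> bool) * (T -> bool)) :=
  if sgn then l.1 else l.2.

(** Ky Fan's alternating simplices: the sum, over all increasing sequences of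
    labels, of the products of their sides taken with alternating signs, the
    first sign being [sgn]. *)
Fixpoint alternating L (sgn : bool) s : bool :=
  if L is l :: L' then
    alternating L' sgn s (+)
    wedge (side sgn l) (fun t => (t == [::]) (+) alternating L' (~~ sgn) t) s
  else false.

Definition total L (x : T) : bool :=
  foldr (fun l u => (l.1 x (+) l.2 x) (+) u) false L.

Fixpoint separated L s : Prop :=
  if L is l :: L' then
    (forall x y, x \in s -> y \in s -> l.1 x -> l.2 y -> false) /\
    separated L' s
  else True.

Lemma separated_sub L s t : {subset t <= s} -> separated L s -> separated L t.
Proof.
move=> ts; elim: L => //= l L IH [ls /IH ?]; split=> // x y /ts xs /ts ys.
exact: ls.
Qed.

Lemma alternating_nil L sgn : alternating L sgn [::] = false.
Proof. by elim: L => //= l L ->. Qed.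

Lemma alternating_size L sgn s : (size L < size s)%N -> alternating L sgn s = false.
Proof.
elim: L sgn s => //= l L IH sgn s ltLs; rewrite IH ?(ltn_trans _ ltLs)//=.
rewrite (@eq_in_wedge _ _ _ (fun=> false)) ?wedge0// => t st _.
have ltLt : (size L < size t)%N by rewrite -ltnS -st.
by rewrite IH// addbF; case: t ltLt {st}.
Qed.

(** Inserting one more vertex in an alternating simplex either cancels in pairs
    or prolongs the alternation, at its head when the sign changes; the product
    with [eq_op^~ [::]] accounts for the one-vertex simplices. By induction on
    the labels: all products of two sides of one label vanish, because both
    sides never meet, or by [wedge_id]. *)
Lemma alternating_step L sgn s : separated L s ->
  wedge (total L) (alternating L sgn) s (+) wedge (total L) (eq_op^~ [::]) s
  = alternating L true s (+) alternating L false s.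
Proof.
elim: L sgn s => [|l L IH] sgn s.
  by rewrite wedge0 (wedge_false (eq_op^~ [::])).
move=> [sepl sepL'].
have sepS t : {subset t <= s} -> separated L t.
  by move=> ts; apply: separated_sub sepL'.
have l12 sg w : wedge (side sg l) (wedge (side (~~ sg) l) w) s = false.
  case: sg => /=; first exact: wedge_disjoint.
  by rewrite wedgeC; apply: wedge_disjoint.
pose e0 : seq T -> bool := eq_op^~ [::].
pose u x := l.1 x (+) l.2 x.
have uE sg w : wedge u w s = wedge (side sg l) w s (+) wedge (side (~~ sg) l) w s.
  by rewrite wedgeDl; case: sg => //=; rewrite addbC.
have totE w : wedge (total (l :: L)) w s = wedge u w s (+) wedge (total L) w s.
  exact: (wedgeDl u (total L)).
pose B t := e0 t (+) alternating L (~~ sgn) t.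
have -> : wedge (total (l :: L)) (alternating (l :: L) sgn) s =
    wedge u (alternating L sgn) s (+) wedge (total L) (alternating L sgn) s
    (+) wedge (side sgn l) (wedge (total L) B) s.
  rewrite totE [in LHS]/= !(wedgeD _ (alternating L sgn)) -/B.
  rewrite (uE sgn (wedge _ B)) wedge_id addFb.
  rewrite (wedgeC (side (~~ sgn) l)) l12 (wedgeC (total L) (side sgn l)).
  by rewrite addbF addbA.
have -> : wedge (side sgn l) (wedge (total L) B) s =
    wedge (side sgn l) (alternating L true) s (+)
    wedge (side sgn l) (alternating L false) s.
  rewrite -wedgeD; apply: eq_in_wedge => t _ ts.
  by rewrite -(IH (~~ sgn) t (sepS t ts)) (wedgeD _ e0) addbC.
have IHs := IH sgn s sepL'; rewrite totE.
rewrite /= !(wedgeD _ e0) -/e0.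
rewrite (uE sgn (alternating L sgn)) (uE true e0) /=.
move: IHs; rewrite -/e0.
case: sgn {B} => /=; move: (alternating L true s) (alternating L false s);
  repeat match goal with |- context [wedge ?a ?w ?t] =>
    move: (wedge a w t) end; do 9 case=> //=.
Qed.

Lemma alternating_swap L sgn s :
  alternating [seq (l.2, l.1) | l <- L] sgn s = alternating L (~~ sgn) s.
Proof.
elim: L sgn s => //= l L IH sgn s; rewrite IH; congr (_ (+) _).
have -> : side sgn (l.2, l.1) = side (~~ sgn) l by case: sgn.
by apply: eq_in_wedge => t _ _; rewrite IH.
Qed.

End Alternating.

Lemma alternating_map (T U : eqType) (f : T -> U) L sgn s :
  alternating L sgn (map f s) =
  alternating [seq (l.1 \o f, l.2 \o f) | l <- L] sgn s.
Proof.
elim: L sgn s => //= l L IH sgn s; rewrite IH wedge_map; congr (_ (+) _).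
have -> : side sgn l \o f = side sgn (l.1 \o f, l.2 \o f) by case: sgn.
by apply: eq_in_wedge => -[|x t] _ _; rewrite /= ?IH// -IH.
Qed.

(** * Spheres, hemispheres and prisms *)

Section Prism.
Variables (T U : eqType) (i0 i1 : T -> U).
Implicit Types (w : seq U -> bool) (s : seq T).

(** The value of w on the standard triangulation of the prism s x [0, 1], with
    bottom face [map i0 s] and top face [map i1 s]. *)
Fixpoint prism w s : bool :=
  if s is x :: s' then
    w (i0 x :: map i1 s) (+) prism (w \o cons (i0 x)) s'
  else false.

Lemma eq_in_prism w w' s :
    (forall t, size t = (size s).+1 ->
       {subset t <= map i0 s ++ map i1 s} -> w t = w' t) ->
  prism w s = prism w' s.
Proof.
elim: s w w' => //= x s IH w w' eqw; congr (_ (+) _).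
  apply: eqw => /= [|y]; first by rewrite size_map.
  by rewrite !(inE, mem_cat) => /or3P[->//|->|->]; rewrite !orbT.
apply: IH => t szt ts; apply: eqw => /=; first by rewrite szt.
move=> y; rewrite !(inE, mem_cat) => /orP[->//|/ts].
by rewrite mem_cat => /orP[]->; rewrite !orbT.
Qed.

Lemma prismD w w' s :
  prism (fun t => w t (+) w' t) s = prism w s (+) prism w' s.
Proof.
elim: s w w' => //= x s IH w w'.
rewrite (IH (w \o cons (i0 x)) (w' \o cons (i0 x))).
by rewrite addbACA.
Qed.

Lemma prism_homotopy w s :
  coboundary (prism w) s (+) prism (coboundary w) s =
  w (map i0 s) (+) w (map i1 s).
Proof.
elim: s w => [|x s IH] w; first by rewrite /= addbb.
rewrite coboundary_cons [prism (coboundary w) _]/= !coboundary_cons.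
pose w0 := w \o cons (i0 x).
have -> : coboundary (prism w \o cons x) s =
  coboundary (w0 \o cons (i1 x)) (map i1 s) (+) coboundary (prism w0) s.
  by rewrite coboundary_map -wedgeD.
have -> : prism (coboundary w \o cons (i0 x)) s =
    prism w s (+) prism (coboundary w0) s.
  by rewrite -prismD.
have := IH w0; rewrite /w0 /=.
move: (prism w s) (coboundary _ _) (coboundary _ _) (prism (coboundary _) s)
  (w (i0 x :: map i0 s)) (w (i0 x :: map i1 s)) (w (i1 x :: map i1 s)).
by do 7 case.
Qed.

End Prism.

Section Frames.
Variables (T : eqType) (v : bool -> nat -> T).
Implicit Types (w : seq T -> bool).

(** With v true i = e_i and v false i = - e_i, the value of w on the fundamental
    cycle of the boundary of the k-dimensional cross-polytope, the sum of all
    its 2 ^ k facets. *)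
Fixpoint sphere k w : bool :=
  if k is k'.+1 then
    sphere k' (w \o cons (v true k')) (+) sphere k' (w \o cons (v false k'))
  else w [::].

(** The cone with apex e_k over the sphere of the first k coordinates. *)
Definition hemisphere k w := sphere k (w \o cons (v true k)).

Fixpoint frame (eps : nat -> bool) k : seq T :=
  if k is k'.+1 then v (eps k') k' :: frame eps k' else [::].

Lemma size_frame eps k : size (frame eps k) = k.
Proof. by elim: k => //= k ->. Qed.

Lemma mem_frame eps k x : x \in frame eps k -> exists2 i, (i < k)%N & x = v (eps i) i.
Proof.
elim: k => //= k IH; rewrite inE => /orP[/eqP->|/IH[i ik ->]].
  by exists k.
by exists i => //; rewrite ltnS ltnW.
Qed.

Lemma eq_frame eps eps' k :
  (forall i, (i < k)%N -> eps i = eps' i) -> frame eps k = frame eps' k.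
Proof.
elim: k => //= k IH eqe; rewrite eqe// IH// => i ik.
by rewrite eqe// ltnS ltnW.
Qed.

Definition update_sign (eps : nat -> bool) b k i := if i == k then b else eps i.

Lemma frame_update eps b k :
  frame (update_sign eps b k) k.+1 = v b k :: frame eps k.
Proof.
rewrite /= /update_sign eqxx; congr (_ :: _); apply: eq_frame => i ik.
by rewrite (ltn_eqF ik).
Qed.

Lemma eq_sphere k w w' : (forall eps, w (frame eps k) = w' (frame eps k)) ->
  sphere k w = sphere k w'.
Proof.
elim: k w w' => [|k IH] w w' eqw /=; first exact: (eqw xpredT).
by congr (_ (+) _); apply: IH => eps /=; rewrite -frame_update.
Qed.

Lemma eq_hemisphere k w w' :
    (forall eps, w (frame eps k.+1) = w' (frame eps k.+1)) ->
  hemisphere k w = hemisphere k w'.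
Proof. by move=> eqw; apply: eq_sphere => eps /=; rewrite -frame_update. Qed.

Lemma sphereD k w w' :
  sphere k (fun s => w s (+) w' s) = sphere k w (+) sphere k w'.
Proof.
elim: k w w' => //= k IH w w'.
rewrite (IH (w \o cons (v true k)) (w' \o cons (v true k))).
by rewrite (IH (w \o cons (v false k)) (w' \o cons (v false k))) addbACA.
Qed.

Lemma sphere0 k : sphere k (fun=> false) = false.
Proof.
have -> : (fun=> false) = (fun t : seq T => false (+) false) by [].
by rewrite sphereD addbb.
Qed.

Lemma sphere_coboundary k w : sphere k (coboundary w) = false.
Proof.
elim: k w => //= k IH w; rewrite !(sphereD k w) !IH.
by rewrite !addbF addbb.
Qed.

(** The boundary of a hemisphere is its equator. *)
Lemma hemisphere_coboundary k w : hemisphere k (coboundary w) = sphere k w.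
Proof. by rewrite /hemisphere (sphereD k w) sphere_coboundary addbF. Qed.

Lemma hemisphereD k w w' :
  hemisphere k (fun s => w s (+) w' s) = hemisphere k w (+) hemisphere k w'.
Proof. exact: (sphereD k (w \o cons _)). Qed.

Variable tau : T -> T.
Hypothesis tauE : forall b k, tau (v b k) = v (~~ b) k.

(** The antipode permutes the facets. *)
Lemma sphere_antipode k w : sphere k (w \o map tau) = sphere k w.
Proof.
elim: k w => //= k IH w.
by rewrite -(IH (w \o cons (v true k))) -(IH (w \o cons (v false k)))
  addbC; congr (_ (+) _); apply: eq_sphere => eps /=; rewrite tauE.
Qed.

Lemma sphere_hemispheres k w :
  sphere k.+1 w = hemisphere k w (+) hemisphere k (w \o map tau).
Proof.
rewrite /= /hemisphere; congr (_ (+) _).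
rewrite -(sphere_antipode k (w \o cons (v false k))).
by apply: eq_sphere => eps /=; rewrite tauE.
Qed.

(** A sphere is the sum of a hemisphere and its antipode, so eta of it is
    eta + eta o tau of a hemisphere. By the hypothesis on [coboundary eta] this is
    eta of the equator, except in dimension 0 where the last term contributes 1. *)
Lemma sphere_parity N (eta : seq T -> bool) :
    eta [::] = false ->
    (forall eps k, (k <= N)%N ->
       let s := frame eps k in
       coboundary eta s = eta s (+) eta (map tau s) (+) (size s == 1%N)) ->
  forall k, (0 < k <= N)%N -> sphere k eta = true.
Proof.
move=> eta0 etaN.
suff step k : (k < N)%N -> sphere k.+1 eta = sphere k eta (+) (k == 0)%N.
  case=> // k /andP[_]; elim: k => [|k IH] kN; first by rewrite step//= eta0.
  by rewrite step// IH// ltnW.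
move=> kN; rewrite sphere_hemispheres -hemisphereD.
have -> : hemisphere k (fun s => eta s (+) (eta \o map tau) s) =
    hemisphere k (fun s => coboundary eta s (+) (size s == 1%N)).
  apply: eq_hemisphere => eps; rewrite (etaN _ k.+1)//=.
  by move: (eta _) (eta _) (_ == _); do 3 case.
rewrite hemisphereD hemisphere_coboundary; congr (_ (+) _).
case: k kN => [//|k] kN; rewrite /hemisphere (@eq_sphere _ _ (fun=> false)).
  exact: sphere0.
by move=> eps /=; rewrite size_frame.
Qed.

End Frames.

Lemma sphere_map (T U : eqType) (f : T -> U) v v' k (w : seq U -> bool) :
    (forall b i, (i < k)%N -> f (v b i) = v' b i) ->
  sphere v k (w \o map f) = sphere v' k w.
Proof.
elim: k w => //= k IH w fv; congr (_ (+) _).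
  rewrite -IH => [|b i ik]; last by rewrite fv// ltnS ltnW.
  by congr sphere; apply/funext => s /=; rewrite fv.
rewrite -IH => [|b i ik]; last by rewrite fv// ltnS ltnW.
by congr sphere; apply/funext => s /=; rewrite fv.
Qed.

(** The twisted situation: eta lives on a cylinder over the cross-polytope, its
    values at both ends are exchanged by the reflection E of the last coordinate,
    and it vanishes above the dimension of the sphere. *)
Section Twist.
Variables (T U : eqType) (i0 i1 : T -> U) (v : bool -> nat -> T).
Variables (tau E : T -> T) (tauU : U -> U) (N : nat) (eta : seq U -> bool).
Hypothesis tauE : forall b k, tau (v b k) = v (~~ b) k.
Hypothesis tau0 : forall x, tauU (i0 x) = i0 (tau x).
Hypothesis tau1 : forall x, tauU (i1 x) = i1 (tau x).
Hypothesis E_fix : forall b i, (i < N)%N -> E (v b i) = v b i.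
Hypothesis E_flip : forall b, E (v b N) = v (~~ b) N.
Hypothesis eta0 : eta [::] = false.
Hypothesis eta_size : forall s, (N.+1 < size s)%N -> eta s = false.
Hypothesis etaE : forall s, eta (map i1 (map E s)) = eta (map i0 s).
Hypothesis eta_antipodal : forall eps k s, (k <= N.+1)%N -> (size s <= N.+2)%N ->
  {subset s <= map i0 (frame v eps k) ++ map i1 (frame v eps k)} ->
  coboundary eta s = eta s (+) eta (map tauU s) (+) (size s == 1%N).

Lemma prism_antipode w s : prism i0 i1 (w \o map tauU) s = prism i0 i1 w (map tau s).
Proof.
elim: s w => //= x s IH w; congr (_ (+) _).
  rewrite tau0 tau1 -!map_comp; congr (w [:: _, _ & _]).
  by apply: eq_map => y /=; rewrite tau1.
rewrite -IH; apply: eq_in_prism => t _ _ /=; by rewrite tau0.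
Qed.

(** The prism of eta is a secondary cochain th which compares both ends:
    th of a sphere of dimension k plus th of its equator is the difference of eta
    on the two end hemispheres ([step]). Below the top dimension E fixes the
    hemispheres, so th vanishes on all spheres by induction. In the top dimension
    th vanishes because the prism is too large, while the two hemispheres
    are exchanged and add up to the whole sphere, where eta is 1 by
    [sphere_parity]. *)
Lemma no_twist : False.
Proof.
pose th := prism i0 i1 eta.
pose e0 := eta \o map i0; pose e1 := eta \o map i1.
have thE eps k : (k <= N.+1)%N -> let s := frame v eps k in
    coboundary th s (+) (th s (+) (th \o map tau) s) = e0 s (+) e1 s.
  move=> kN s; rewrite -[RHS]prism_homotopy; congr (_ (+) _).
  case: k kN @s => [|k] kN s //.
  rewrite [RHS](@eq_in_prism _ _ _ _ _
    (fun t => (eta t (+) (eta \o map tauU) t))); last first.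
    move=> t szt ts; rewrite (eta_antipodal kN _ ts) szt size_frame ?addbF//;
    exact: (ltnW kN).
  by rewrite prismD prism_antipode.
have step k : (k <= N)%N ->
    sphere v k.+1 th (+) sphere v k th = hemisphere v k e0 (+) hemisphere v k e1.
  move=> kN; rewrite (sphere_hemispheres tauE) -!hemisphereD.
  rewrite -(hemisphere_coboundary v k th) -hemisphereD.
  apply: eq_hemisphere => eps; have := thE eps k.+1 kN.
  rewrite /= -/(frame v eps k); move: (coboundary _ _) (th _) (th _) (e0 _) (e1 _).
  by do 5 case.
have e1E s : e1 (map E s) = e0 s by exact: etaE.
have e01 k : (k < N)%N -> hemisphere v k e0 = hemisphere v k e1.
  move=> kN; rewrite /hemisphere -[RHS](@sphere_map _ _ E v v) => [|b i ik].
    by congr sphere; apply/funext => s /=; rewrite -e1E /= E_fix.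
  by rewrite E_fix// (ltn_trans ik).
have th0 k : (k <= N)%N -> sphere v k th = false.
  elim: k => [|k IH] kN; first by [].
  have := step k (ltnW kN); rewrite (e01 k kN) (IH (ltnW kN)) addbb.
  by case: (sphere v k.+1 th).
have thN : sphere v N.+1 th = false.
  rewrite (@eq_sphere _ _ _ _ (fun=> false)); last first.
    move=> eps; rewrite /th (@eq_in_prism _ _ _ _ _ (fun=> false)).
      have -> : (fun=> false) = (fun t : seq U => false (+) false) by [].
      by rewrite prismD addbb.
    by move=> t szt _; rewrite eta_size// szt size_frame.
  exact: sphere0.
have := step N (leqnn N); rewrite thN (th0 N (leqnn N)) addbb.
have -> : hemisphere v N e1 = sphere v N (e0 \o cons (v false N)).
  rewrite /hemisphere -[LHS](@sphere_map _ _ E v v) => [|b i ik].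
    by congr sphere; apply/funext => s /=; rewrite -e1E /= E_flip.
  by rewrite E_fix.
suff eN : sphere v N.+1 e0 = true by move: eN; rewrite /= => ->.
apply: (@sphere_parity _ _ _ tauE N.+1) => //; last by rewrite ltnSn.
move=> eps k kN s; rewrite /e0 -coboundary_map (eta_antipodal (eps := eps) kN).
- rewrite size_map /= -!map_comp; congr (_ (+) eta _ (+) _).
  by apply: eq_map => x /=; rewrite tau0.
- by rewrite size_map size_frame leqW.
- by move=> x xs; rewrite mem_cat xs.
Qed.

End Twist.

(** * Barycentric subdivision of cochains *)

Section Subdivision.
Variables (R : realType) (V : normedModType R).
Implicit Types (s t : seq V) (w : seq V -> bool) (C : V -> Prop).

Definition barycenter s : V := (size s)%:R^-1 *: \sum_(x <- s) x.

Definition convex C :=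
  forall x y (c : R), 0 <= c <= 1 -> C x -> C y -> C (c *: x + (1 - c) *: y).

Definition affine_map (g : V -> V) :=
  forall x y (c : R), g (c *: x + (1 - c) *: y) = c *: g x + (1 - c) *: g y.

(** Convex hulls only matter through the convex sets that contain them. *)
Definition in_hull s t :=
  forall C, convex C -> (forall x, x \in s -> C x) -> forall y, y \in t -> C y.

Definition mesh_le (D : R) s := forall x y, x \in s -> y \in s -> `|x - y| <= D.

Lemma barycenter_cons x s : s != [::] ->
  barycenter (x :: s) =
  (size s).+1%:R^-1 *: x + (1 - (size s).+1%:R^-1) *: barycenter s.
Proof.
move=> s0; have sz : (size s)%:R != 0 :> R by rewrite pnatr_eq0 size_eq0.
rewrite /barycenter big_cons scalerDr scalerA; congr (_ + _ *: _).
rewrite [size _]/= -natr1; field.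
by rewrite sz natr1 pnatr_eq0.
Qed.

Lemma barycenter1 x : barycenter [:: x] = x.
Proof. by rewrite /barycenter big_seq1 /= invr1 scale1r. Qed.

Lemma barycenter_convex C s : convex C -> s != [::] ->
  (forall x, x \in s -> C x) -> C (barycenter s).
Proof.
move=> cC; elim: s => // x s IH _ Cs.
have [s0|s_neq0] := eqVneq s [::].
  by rewrite s0 barycenter1; apply: Cs; rewrite mem_head.
rewrite barycenter_cons//; apply: cC.
- by rewrite invr_ge0 ler0n invf_le1 ?ltr0n// ler1n.
- by apply: Cs; rewrite mem_head.
- by apply: IH => // y ys; apply: Cs; rewrite inE ys orbT.
Qed.

Lemma barycenter_map (g : V -> V) s : affine_map g -> s != [::] ->
  barycenter (map g s) = g (barycenter s).
Proof.
move=> ag; elim: s => // x s IH _.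
have [->|s0] := eqVneq s [::]; first by rewrite /= !barycenter1.
by rewrite /= !barycenter_cons -?size_eq0 ?size_map ?size_eq0// ag IH.
Qed.

(** The barycenter b of k points satisfies k (b - x) = sum of (y - x), where the
    term y = x vanishes. *)
Lemma barycenter_dist D s x : mesh_le D s -> x \in s ->
  `|barycenter s - x| <= (1 - (size s)%:R^-1) * D.
Proof.
move=> Ds xs; have sz : (0 < size s)%N by case: s xs {Ds}.
have sz0 : (size s)%:R != 0 :> R by rewrite pnatr_eq0 -lt0n.
have D0 : 0 <= D by apply: le_trans (Ds x x xs xs); rewrite normr_ge0.
have -> : barycenter s - x = (size s)%:R^-1 *: \sum_(y <- s) (y - x).
  rewrite big_split /= sumrN big_const_seq count_predT iter_addr_0.
  by rewrite scalerBr -(scaler_nat (size s) x) scalerA mulVf// scale1r.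
rewrite normrZ ger0_norm ?invr_ge0 ?ler0n//.
rewrite (perm_big _ (perm_to_rem xs)) big_cons subrr [_ 0 _]add0r.
have le_sum : `|\sum_(y <- rem x s) (y - x)| <= ((size s)%:R - 1) * D.
  apply: le_trans (ler_norm_sum _ _ _) _.
  have -> : ((size s)%:R - 1) * D = \sum_(y <- rem x s) D.
    rewrite big_const_seq count_predT iter_addr_0 size_rem// -[RHS]mulr_natl.
    by rewrite -subn1 natrB.
  rewrite big_seq_cond [leRHS]big_seq_cond; apply: ler_sum => y.
  by rewrite andbT => /mem_rem ys; apply: Ds.
apply: le_trans (ler_wpM2l _ le_sum) _; first by rewrite invr_ge0 ler0n.
by rewrite mulrA mulrBr mulVf// mulr1.
Qed.

Lemma convex_ball (z : V) (e : R) : convex (fun x => `|z - x| <= e).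
Proof.
move=> x y c /andP[c0 c1] zx zy.
have -> : z - (c *: x + (1 - c) *: y) = c *: (z - x) + (1 - c) *: (z - y).
  rewrite !scalerBr addrACA -scalerDl addrC -opprD [in RHS]addrC.
  by rewrite addrCA subrr addr0 scale1r addrC.
apply: le_trans (ler_normD _ _) _.
rewrite !normrZ (ger0_norm c0) ger0_norm ?subr_ge0//.
have -> : e = c * e + (1 - c) * e by rewrite -mulrDl addrCA subrr addr0 mul1r.
by apply: lerD; apply: ler_wpM2l; rewrite ?subr_ge0.
Qed.

(** The dual of barycentric subdivision: the subdivision of a simplex is the cone
    from its barycenter over the subdivision of its boundary, so that the value of
    the subdivided cochain is the coboundary of the subdivided cone cochain. The
    first argument is the size of the sequence and makes the recursion structural. *)
Fixpoint subdivide_rec k w s : bool :=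
  if k is k'.+1 then
    coboundary (subdivide_rec k' (w \o cons (barycenter s))) s
  else w s.

Definition subdivide w s := subdivide_rec (size s) w s.

Lemma subdivideS w s : s != [::] ->
  subdivide w s = coboundary (subdivide (w \o cons (barycenter s))) s.
Proof.
case: s => // x s _; rewrite {1}/subdivide [LHS]/=.
by apply: eq_in_wedge => t [szt] _; rewrite /subdivide szt.
Qed.

Lemma subdivide_nil w : subdivide w [::] = w [::].
Proof. by []. Qed.

Lemma subdivideD w w' s :
  subdivide (fun t => w t (+) w' t) s = subdivide w s (+) subdivide w' s.
Proof.
have [n] := ubnP (size s); elim: n s w w' => // n IH s w w' szs.
have [->//|s0] := eqVneq s [::].
rewrite !subdivideS// -wedgeD; apply: eq_in_wedge => t szt _.
by rewrite -IH// -ltnS -szt.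
Qed.

(** Subdivision replaces a simplex by simplices in its hull whose diameter is
    smaller by the factor 1 - 1/N. *)
Lemma subdivide_local (N : nat) (D : R) w w' s : (size s <= N)%N -> mesh_le D s ->
    (forall t, size t = size s -> in_hull s t ->
       mesh_le ((1 - N%:R^-1) * D) t -> w t = w' t) ->
  subdivide w s = subdivide w' s.
Proof.
elim: {s}(size s) {-2}s (erefl (size s)) w w' => [|k IH] s szs w w' kN Ds eqw.
  move/size0nil: szs => s0; move: eqw; rewrite s0 => eqw.
  by rewrite !subdivide_nil; apply: eqw.
have s0 : s != [::] by rewrite -size_eq0 szs.
rewrite !subdivideS//; apply: eq_in_wedge => t; rewrite szs => -[szt] ts.
apply: IH; rewrite -?szt//; first by rewrite szs in kN; apply: ltnW.
  by move=> x y /ts xs /ts ys; apply: Ds.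
move=> u szu tu Du /=.
have hsu : in_hull s u by move=> C cC Cs; apply: tu => // x /ts; apply: Cs.
apply: eqw => /=; first by rewrite szu.
  move=> C cC Cs y; rewrite inE => /orP[/eqP->|yu]; last exact: hsu yu.
  exact: barycenter_convex.
have D0 : 0 <= D.
  case: (s) s0 Ds => // x s' _ /(_ x x (mem_head _ _) (mem_head _ _)).
  exact: le_trans.
have bs x : x \in s -> `|barycenter s - x| <= (1 - N%:R^-1) * D.
  move=> xs; apply: le_trans (barycenter_dist Ds xs) _.
  apply: ler_wpM2r => //; rewrite lerD2l lerN2.
  have sz0 : (0 < size s)%N by rewrite szs.
  have N0 : (0 < N)%N by apply: leq_trans kN.
  by rewrite lef_pV2 ?posrE ?ltr0n// ler_nat.
have bu x : x \in u -> `|barycenter s - x| <= (1 - N%:R^-1) * D.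
  by move=> xu; apply: (hsu _ (@convex_ball _ _) bs).
have rD0 : 0 <= (1 - N%:R^-1) * D.
  by have x0 : head 0 s \in s; [case: (s) s0 => // *; apply: mem_head|
     apply: le_trans (bs _ x0)].
move=> x y; rewrite !inE => /orP[/eqP->|xu] /orP[/eqP->|yu].
- by rewrite subrr normr0.
- exact: bu.
- by rewrite distrC; apply: bu.
- exact: Du.
Qed.

(** By induction on the size: writing w_b for the cone cochain, the coboundary of
    d w coned off at b is w + d (w_b), and d d = 0 removes the second term. *)
Lemma coboundary_subdivide w s :
  coboundary (subdivide w) s = subdivide (coboundary w) s.
Proof.
have [n] := ubnP (size s); elim: n s w => // n IH s w szs.
have [->//|s0] := eqVneq s [::].
rewrite subdivideS//.
rewrite [RHS](@eq_in_wedge _ _ _ (fun t => subdivide w t (+)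
  coboundary (subdivide (w \o cons (barycenter s))) t)); last first.
  move=> t szt _; rewrite (subdivideD w); congr (_ (+) _).
  by rewrite IH// -ltnS -szt.
by rewrite (wedgeD _ (subdivide w)) wedge_id addbF.
Qed.

Lemma subdivide_map (f : V -> V) w s : affine_map f ->
  subdivide w (map f s) = subdivide (w \o map f) s.
Proof.
move=> fb; have [n] := ubnP (size s); elim: n s w => // n IH s w szs.
have [->//|s0] := eqVneq s [::].
have fs0 : map f s != [::] by rewrite -size_eq0 size_map size_eq0.
rewrite !subdivideS// coboundary_map; apply: eq_in_wedge => t szt _ /=.
rewrite IH; last by rewrite -ltnS -szt.
by congr subdivide; apply/funext => u /=; rewrite barycenter_map.
Qed.

Definition subdivisions m w := iter m subdivide w.

Lemma subdivisions_nil m w : subdivisions m w [::] = w [::].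
Proof. by elim: m. Qed.

Lemma subdivisionsD m w w' s :
  subdivisions m (fun t => w t (+) w' t) s =
  subdivisions m w s (+) subdivisions m w' s.
Proof.
elim: m s => //= m IH s.
by rewrite -subdivideD; congr subdivide; apply/funext => t; apply: IH.
Qed.

Lemma subdivisions_local N (m : nat) (D : R) w w' s : (size s <= N)%N ->
    mesh_le D s ->
    (forall t, size t = size s -> in_hull s t ->
       mesh_le ((1 - N%:R^-1) ^+ m * D) t -> w t = w' t) ->
  subdivisions m w s = subdivisions m w' s.
Proof.
elim: m D s => [|m IH] D s sN Ds eqw /=.
  by apply: eqw; [|move=> C _|rewrite expr0 mul1r].
apply: (subdivide_local sN Ds) => t szt st Dt.
apply: (IH _ t _ Dt); first by rewrite szt.
move=> u szu tu Du; apply: eqw; first by rewrite szu.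
  by move=> C cC Cs; apply: tu => //; apply: st.
by rewrite exprSr -mulrA.
Qed.

Lemma coboundary_subdivisions m w s :
  coboundary (subdivisions m w) s = subdivisions m (coboundary w) s.
Proof.
elim: m s => //= m IH s; rewrite coboundary_subdivide.
by congr subdivide; apply/funext => t; apply: IH.
Qed.

Lemma subdivisions_map m (f : V -> V) w s : affine_map f ->
  subdivisions m w (map f s) = subdivisions m (w \o map f) s.
Proof.
move=> fb; elim: m s => //= m IH s; rewrite subdivide_map//.
by congr subdivide; apply/funext => t; apply: IH.
Qed.

Lemma subdivide_size w s :
  (forall t, size t = size s -> w t = false) -> subdivide w s = false.
Proof.
have [n] := ubnP (size s); elim: n s w => // n IH s w szs w0.
have [s0|s0] := eqVneq s [::]; first by rewrite s0 subdivide_nil w0// s0.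
rewrite subdivideS// /coboundary (@eq_in_wedge _ _ _ (fun=> false)) ?wedge0// => t szt _.
apply: IH => [|u szu /=]; first by rewrite -ltnS -szt.
by apply: w0; rewrite /= szu szt.
Qed.

Lemma subdivisions_size m w s :
  (forall t, size t = size s -> w t = false) -> subdivisions m w s = false.
Proof.
elim: m s => [|m IH] s w0 /=; first exact: w0.
by apply: subdivide_size => t szt; apply: IH => u; rewrite szt; apply: w0.
Qed.

Lemma subdivisions_one m s :
  subdivisions m (fun t => size t == 1%N) s = (size s == 1%N).
Proof.
elim: m s => //= m IH s.
have -> : subdivisions m (fun t => size t == 1%N) = (fun t => size t == 1%N).
  exact/funext.
case: s => [|x [|y s]] //.
by apply: subdivide_size => t ->.
Qed.

End Subdivision.

(** * The cochain of an odd family of functions *)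

Section CompactBounds.
Local Open Scope classical_set_scope.
Variables (R : realType) (V : normedModType R) (K : set V).
Hypothesis cK : compact K.

(** The pairs at which f oscillates by at least d form a compact set on which the
    distance has a positive minimum. *)
Lemma compact_uniform (f : V -> R) (d : R) : continuous f -> 0 < d ->
  exists2 e, 0 < e & forall x y, K x -> K y -> `|x - y| < e -> `|f x - f y| < d.
Proof.
move=> cf d0.
pose g (z : V * V) := `|f z.1 - f z.2|.
have cg : continuous g.
  move=> z; apply: cvg_norm; apply: cvgB.
    by apply: (continuous_comp (g := f)); [exact: cvg_fst|exact: cf].
  by apply: (continuous_comp (g := f)); [exact: cvg_snd|exact: cf].
pose A := (K `*` K) `&` (g @^-1` [set t | d <= t]).
have cA : compact A.
  apply: compact_closedI; first exact: compact_setX.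
  by apply: preimage_closed; [move=> x _; exact: cg|exact: closed_ge].
have [[z Az]|A0] := pselect (A !=set0); last first.
  exists 1 => // x y Kx Ky _; rewrite ltNge; apply/negP => dxy.
  by apply: A0; exists (x, y).
pose h (z : V * V) := `|z.1 - z.2|.
have ch : continuous h.
  by move=> u; apply: cvg_norm; apply: cvgB; [exact: cvg_fst|exact: cvg_snd].
have [|c cA0 hc] := @compact_EVT_min _ R h A (ex_intro _ z Az) cA.
  exact: continuous_subspaceT.
exists (h c).
  rewrite normr_gt0 subr_eq0; apply/eqP => c12.
  move: cA0; rewrite inE => -[_]; rewrite /= /g c12 subrr normr0.
  by rewrite leNgt d0.
move=> x y Kx Ky; apply: contraTT; rewrite -!leNgt => dxy.
by apply: (hc (x, y)); rewrite inE.
Qed.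

Lemma compact_uniform_family (I : seq nat) (f : nat -> V -> R) (d : R) :
    (forall i, i \in I -> continuous (f i)) -> 0 < d ->
  exists2 e, 0 < e & forall i x y, i \in I -> K x -> K y -> `|x - y| < e ->
    `|f i x - f i y| < d.
Proof.
move=> + d0; elim: I => [|i I IH] cf; first by exists 1.
have [e1 e10 he1] : exists2 e, 0 < e & forall i x y, i \in I -> K x -> K y ->
    `|x - y| < e -> `|f i x - f i y| < d.
  by apply: IH => j jI; apply: cf; rewrite inE jI orbT.
have [e2 e20 he2] := compact_uniform (cf i (mem_head _ _)) d0.
exists (Num.min e1 e2); first by rewrite lt_min e10.
move=> j x y; rewrite inE lt_min => jI Kx Ky /andP[? ?].
by case/orP: jI => [/eqP->|jI]; [exact: he2|exact: he1].
Qed.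

(** The sum of the |f i| has a positive minimum, which one of its terms must share. *)
Lemma compact_nonvanishing (I : seq nat) (f : nat -> V -> R) :
    (forall i, i \in I -> continuous (f i)) ->
    (forall x, K x -> exists2 i, i \in I & f i x != 0) ->
  exists2 d, 0 < d & forall x, K x -> exists2 i, i \in I & d <= `|f i x|.
Proof.
move=> cf f0.
have [[z Kz]|K0] := pselect (K !=set0); last first.
  by exists 1 => // x Kx; case: K0; exists x.
pose F x := \sum_(i <- I) `|f i x|.
have cF : continuous F.
  have -> : F = fun x => \sum_(i <- I | i \in I) `|f i x|.
    by apply/funext => x; rewrite /F big_seq.
  apply: (continuous_big (P := fun i => i \in I)) => [|i /cf fi y].
    exact: add_continuous.
  by apply: cvg_norm; exact: fi.
have [|c cA hc] := @compact_EVT_min _ R F K (ex_intro _ z Kz) cK.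
  exact: continuous_subspaceT.
have Fc0 : 0 < F c.
  have [i iI fi] := f0 c (set_mem cA).
  rewrite /F (perm_big _ (perm_to_rem iI)) big_cons.
  apply: (@lt_le_trans _ _ (`|f i c| + 0)); first by rewrite addr0 normr_gt0.
  by rewrite lerD2l; apply: sumr_ge0.
exists (F c / (size I).+1%:R); first by rewrite divr_gt0// ltr0n.
move=> x Kx; apply/hasP; apply/negPn/negP => /hasPn hI.
have := hc x (mem_set Kx); apply/negP; rewrite -ltNge.
apply: (@le_lt_trans _ _ (\sum_(i <- I) F c / (size I).+1%:R)).
  rewrite /F big_seq [leRHS]big_seq; apply: ler_sum => i /hI.
  by rewrite -ltNge => /ltW.
rewrite big_const_seq count_predT iter_addr_0 -[ltLHS]mulr_natr mulrAC.
by rewrite ltr_pdivrMr ?ltr0n// ltr_pM2l// ltr_nat.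
Qed.

End CompactBounds.

Section Labels.
Variables (R : realType) (V : normedModType R) (f : nat -> V -> R).
Implicit Types (I : seq nat) (d : R) (P : V -> bool).

(** A point x gets the first index i with |f i x| >= d as its label, on the side
    given by the sign of f i x. The guard P says that no earlier index was
    eligible. *)
Fixpoint labels d P I : seq ((V -> bool) * (V -> bool)) :=
  if I is i :: I' then
    (fun x => P x && (d <= f i x), fun x => P x && (f i x <= - d))
    :: labels d (fun x => P x && (`|f i x| < d)) I'
  else [::].

Lemma size_labels d P I : size (labels d P I) = size I.
Proof. by elim: I P => //= i I IH P; rewrite IH. Qed.

Lemma total_labels d P I x : 0 < d ->
  total (labels d P I) x = P x && has (fun i => d <= `|f i x|) I.
Proof.
move=> d0; elim: I P => [|i I IH] P /=; first by rewrite andbF.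
rewrite -/(total _ x) IH; case: (P x) => //=.
rewrite ltNge ler_normr; case: (leP d (f i x)) => [dx|xd] /=.
  suff -> : (f i x <= - d) = false by [].
  by apply/negbTE; rewrite -ltNge (lt_le_trans _ dx)// ltrNl (lt_trans _ d0)// ltrNl oppr0.
by rewrite lerNr; case: (d <= - f i x).
Qed.

(** Points on opposite sides of the label i have values of f i at least 2 d apart. *)
Lemma separated_labels d P I s :
    (forall i x y, i \in I -> x \in s -> y \in s -> `|f i x - f i y| < d) ->
  0 < d -> separated (labels d P I) s.
Proof.
move=> + d0; elim: I P => //= i I IH P fI; split.
  move=> x y xs ys /andP[_ dx] /andP[_ yd].
  suff : ~ (`|f i x - f i y| < d) by case; apply: fI; rewrite ?mem_head.
  apply/negP; rewrite -leNgt.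
  apply: le_trans (ler_norm _); rewrite -[leLHS]addr0 lerD// lerNr oppr0.
  by apply: le_trans yd _; rewrite lerNl oppr0 ltW.
by apply: IH => j x y jI; apply: fI; rewrite inE jI orbT.
Qed.

Lemma labels_invariant d I (g : V -> V) :
    (forall i x, i \in I -> f i (g x) = f i x) ->
  [seq (l.1 \o g, l.2 \o g) | l <- labels d xpredT I] = labels d xpredT I.
Proof.
move=> fg.
suff H P : P \o g = P ->
    [seq (l.1 \o g, l.2 \o g) | l <- labels d P I] = labels d P I by exact: H.
elim: I P fg => //= i I IH P fg Pg.
have Pgx x : P (g x) = P x by rewrite -[in RHS]Pg.
congr ((_, _) :: _).
- by apply/funext => x /=; rewrite Pgx fg ?mem_head.
- by apply/funext => x /=; rewrite Pgx fg ?mem_head.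
- apply: IH => [j x jI|]; first by rewrite fg// inE jI orbT.
  by apply/funext => x /=; rewrite Pgx fg ?mem_head.
Qed.

(** An antipode exchanges the sides of all labels. *)
Lemma labels_odd d I (g : V -> V) :
    (forall i x, i \in I -> f i (g x) = - f i x) ->
  [seq (l.1 \o g, l.2 \o g) | l <- labels d xpredT I] =
  [seq (l.2, l.1) | l <- labels d xpredT I].
Proof.
move=> fg.
suff H P : P \o g = P ->
    [seq (l.1 \o g, l.2 \o g) | l <- labels d P I] =
    [seq (l.2, l.1) | l <- labels d P I] by exact: H.
elim: I P fg => //= i I IH P fg Pg.
have Pgx x : P (g x) = P x by rewrite -[in RHS]Pg.
congr ((_, _) :: _).
- by apply/funext => x /=; rewrite Pgx fg ?mem_head// lerNr.
- by apply/funext => x /=; rewrite Pgx fg ?mem_head// lerNl opprK.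
- apply: IH => [j x jI|]; first by rewrite fg// inE jI orbT.
  by apply/funext => x /=; rewrite Pgx fg ?mem_head// normrN.
Qed.

End Labels.

Lemma wedge_one_nil (T : eqType) (s : seq T) :
  coboundary (eq_op^~ [::]) s = (size s == 1%N).
Proof.
case: s => // x s; rewrite coboundary_cons /= eqSS size_eq0.
by rewrite /coboundary (@eq_in_wedge _ _ _ (fun=> false)) ?wedge0 ?addbF.
Qed.

Section AntipodalCochain.
Local Open Scope classical_set_scope.
Variables (R : realType) (V : normedModType R) (K : set V) (f : nat -> V -> R).
Variables (m N : nat) (D : R) (tau : V -> V).
Hypothesis cK : compact K.
Hypothesis f_cont : forall i, (i < m)%N -> continuous (f i).
Hypothesis f_neq0 : forall x, K x -> exists2 i, (i < m)%N & f i x != 0.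
Hypothesis f_odd : forall i x, (i < m)%N -> f i (tau x) = - f i x.
Hypothesis tau_affine : affine_map tau.

(** On small simplices inside K the labels cover everything and are separated, so
    the alternating cochain satisfies the identity by [alternating_step], its
    second sign being the antipode of the first by [labels_odd]. Enough
    subdivisions carry the identity from small simplices to those of size N and
    mesh D; subdivision commutes with the coboundary and with affine maps, and
    preserves the indicator of one-point sequences. *)
Lemma antipodal_cochain : exists eta : seq V -> bool, [/\ eta [::] = false,
  forall s, (m < size s)%N -> eta s = false,
  forall g : V -> V, affine_map g ->
    (forall i x, (i < m)%N -> f i (g x) = f i x) ->
    forall s, eta (map g s) = eta s
  & forall C s, convex C -> (forall x, C x -> K x) ->
    (forall x, x \in s -> C x) -> (size s <= N)%N -> mesh_le D s ->
    coboundary eta s = eta s (+) eta (map tau s) (+) (size s == 1%N)].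
Proof.
have mI i : (i \in iota 0 m) = (i < m)%N by rewrite mem_iota.
have [d d0 hd] : exists2 d, 0 < d &
    forall x, K x -> exists2 i, i \in iota 0 m & d <= `|f i x|.
  apply: compact_nonvanishing => // [i|x /f_neq0[i im fi]].
    by rewrite mI; exact: f_cont.
  by exists i => //; rewrite mI.
have [e e0 he] : exists2 e, 0 < e & forall i x y, i \in iota 0 m ->
    K x -> K y -> `|x - y| < e -> `|f i x - f i y| < d.
  by apply: compact_uniform_family => // i; rewrite mI; exact: f_cont.
(* The number M of subdivisions that brings the mesh D below the modulus e. *)
have [M hM] : exists M, (0 < N)%N -> (1 - N%:R^-1) ^+ M * D < e.
  have [N0|N0] := posnP N; first by exists 0%N.
  have r1 : `|1 - N%:R^-1| < 1 :> R.
    rewrite ger0_norm ?ltrBlDr ?ltrDl ?invr_gt0 ?ltr0n// subr_ge0.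
    by rewrite invf_le1 ?ltr0n// ler1n.
  have : (fun M => (1 - N%:R^-1) ^+ M * D : R) @ \oo --> (0 : R).
    by rewrite -[X in _ --> X](mul0r D); apply: cvgMl; exact: cvg_expr.
  move=> /cvgr0Pnorm_lt/(_ e e0)[M _ /(_ M (leqnn M))] hM.
  by exists M => _; apply: le_lt_trans (ler_norm _) hM.
pose L := labels f d xpredT (iota 0 m).
exists (subdivisions M (alternating L true)); split.
- by rewrite subdivisions_nil alternating_nil.
- move=> s ms; apply: subdivisions_size => t szt; apply: alternating_size.
  by rewrite size_labels size_iota szt.
- move=> g gb fg s; rewrite subdivisions_map//; congr subdivisions.
  apply/funext => t /=; rewrite alternating_map labels_invariant// => i x.
  by rewrite mI; exact: fg.
- move=> C s cC CK Cs sN Ds; rewrite coboundary_subdivisions.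
  rewrite -(subdivisions_one M) subdivisions_map// -!subdivisionsD.
  apply: (subdivisions_local sN Ds) => t szt st Dt.
  have Kt x : x \in t -> K x by move=> xt; apply/CK/(st C).
  have sepL : separated L t.
    apply: separated_labels => // i x y iI xt yt; apply: he => //; try exact: Kt.
    apply: le_lt_trans (Dt _ _ xt yt) _; apply: hM => //.
    by apply: leq_trans sN; rewrite -szt; case: (t) xt.
  have totL : {in t, total L =1 xpredT}.
    move=> x xt; rewrite total_labels//=; apply/hasP.
    by have [i iI di] := hd x (Kt x xt); exists i.
  have := alternating_step true sepL.
  rewrite !(eq_in_wedgel _ totL) -!/(coboundary _ _) wedge_one_nil.
  move=> /(congr1 (addb^~ (size t == 1%N))); rewrite -addbA addbb addbF => ->.
  congr (_ (+) _ (+) _).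
  rewrite /= alternating_map labels_odd ?alternating_swap// => i x.
  by rewrite mI; exact: f_odd.
Qed.

End AntipodalCochain.

(** * Borsuk-Ulam and its reflected version *)

Section CrossPolytope.
Local Open Scope classical_set_scope.
Variables (R : realType) (N : nat).
Let n := N.+1.
Let W := 'rV[R]_n.
Let V := (W * R)%type.

Definition l1norm (x : W) : R := \sum_i `|x 0 i|.

(** The boundary of the cross-polytope times the interval [0, 1]. *)
Definition cylinder : set V := [set x | l1norm x = 1] `*` `[0, 1].

Lemma l1norm_continuous : continuous l1norm.
Proof.
apply: continuous_big => [|i _ x]; first exact: add_continuous.
by apply: (continuous_comp (f := fun y : W => y 0 i)) => //;
  [exact: coord_continuous|exact: norm_continuous].
Qed.

Lemma cylinder_compact : compact cylinder.
Proof.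
apply: (@compact_setX W R); last exact: segment_compact.
apply: bounded_closed_compact.
  exists 1; split; first exact: num_real.
  move=> M M1 x /= x1; apply: le_trans (ltW M1); rewrite -x1.
  rewrite /Num.norm /= mx_normrE; apply/bigmax_leP; split.
    by rewrite x1.
  move=> [i j] _ /=; rewrite (ord1 i) /l1norm (bigD1 j)//= lerDl.
  exact: sumr_ge0.
apply: (@preimage_closed _ _ l1norm [set t | t = 1]).
  by move=> x _; exact: l1norm_continuous.
exact: closed_eq.
Qed.

Definition vertex (b : bool) (k : nat) : W := (-1) ^+ (~~ b) *: delta_mx 0 (inord k).

(** The product with [0, 1] of the facet with sign vector eps. *)
Definition cell (eps : nat -> bool) (x : V) : Prop :=
  [/\ \sum_(i < n) (-1) ^+ (~~ eps i) * x.1 0 i = 1,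
      forall i : 'I_n, 0 <= (-1) ^+ (~~ eps i) * x.1 0 i & 0 <= x.2 <= 1].

Lemma cell_convex eps : convex (cell eps).
Proof.
move=> x y c /andP[c0 c1] [x1 x0 xI] [y1 y0 yI]; split.
- transitivity (c * (\sum_(i < n) (-1) ^+ (~~ eps i) * x.1 0 i) +
    (1 - c) * (\sum_(i < n) (-1) ^+ (~~ eps i) * y.1 0 i)).
    by rewrite !mulr_sumr -big_split; apply: eq_bigr => i _; rewrite /= !mxE; ring.
  by rewrite x1 y1 !mulr1 addrCA subrr addr0.
- move=> i; have -> : (-1) ^+ (~~ eps i) * (c *: x + (1 - c) *: y).1 0 i =
    c * ((-1) ^+ (~~ eps i) * x.1 0 i) + (1 - c) * ((-1) ^+ (~~ eps i) * y.1 0 i).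
    by rewrite /= !mxE; ring.
  by apply: addr_ge0; apply: mulr_ge0; rewrite ?subr_ge0.
- have unit_itv (a b : R) : 0 <= a <= 1 -> 0 <= b <= 1 ->
      0 <= c * a + (1 - c) * b <= 1 by nra.
  exact: unit_itv.
Qed.

Lemma cell_cylinder eps x : cell eps x -> cylinder x.
Proof.
move=> [x1 x0 xI]; split=> /=; last by rewrite in_itv.
rewrite -x1; apply: eq_bigr => i _.
rewrite -[RHS]ger0_norm// normrM.
by rewrite normrX normrN1 expr1n mul1r.
Qed.

Lemma vertex_cell eps i (t : R) : (i < n)%N -> 0 <= t <= 1 ->
  cell eps (vertex (eps i) i, t).
Proof.
move=> iN tI; have E (j : 'I_n) : (-1) ^+ (~~ eps j) * vertex (eps i) i 0 j =
    (j == inord i)%:R.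
  rewrite !mxE eqxx /=; have [->|_] := eqVneq j _; last by rewrite !mulr0.
  by rewrite inordK// mulr1 -expr2 sqrr_sign.
split=> //= => [|j]; last by rewrite E ler0n.
rewrite (eq_bigr _ (fun j _ => E j)) (bigD1 (inord i))//= eqxx big1 ?addr0//.
by move=> j /negbTE ->.
Qed.

Lemma cylinder_antipodal_cochain (m : nat) (f : nat -> V -> R) :
    (forall i, (i < m)%N -> continuous (f i)) ->
    (forall i x, (i < m)%N -> f i (- x.1, x.2) = - f i x) ->
    (forall x, cylinder x -> exists2 i, (i < m)%N & f i x != 0) ->
  exists eta : seq V -> bool, [/\ eta [::] = false,
    forall s, (m < size s)%N -> eta s = false,
    forall g : V -> V, affine_map g ->
      (forall i x, (i < m)%N -> f i (g x) = f i x) ->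
      forall s, eta (map g s) = eta s
    & forall eps k s, (k <= n)%N -> (size s <= n.+1)%N ->
      {subset s <= map (pair^~ 0) (frame vertex eps k) ++
                   map (pair^~ 1) (frame vertex eps k)} ->
      coboundary eta s =
      eta s (+) eta (map (fun x => (- x.1, x.2)) s) (+) (size s == 1%N)].
Proof.
move=> cf fodd f0.
have [D hD] : exists D, forall s, (forall x, x \in s -> cylinder x) -> mesh_le D s.
  have [M [_ hM]] := compact_bounded cylinder_compact.
  exists ((M + 1) + (M + 1)) => s sK x y /sK Kx /sK Ky.
  have MM : M < M + 1 by rewrite ltrDl.
  by apply: le_trans (ler_normB _ _) _; apply: lerD; exact: hM MM _ _.
have tau_aff : affine_map (fun x : V => (- x.1, x.2)).
  by move=> x y c; congr pair; rewrite /= opprD !scalerN.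
have [eta [eta0 etaS etaI etaT]] :=
  @antipodal_cochain R V cylinder f m n.+1 D (fun x => (- x.1, x.2)) cylinder_compact cf f0
    fodd tau_aff.
exists eta; split=> // eps k s kn sn sf.
have Cs x : x \in s -> cell eps x.
  move=> /sf; rewrite mem_cat => /orP[] /mapP[w /mem_frame[i ik ->] ->];
    by apply: vertex_cell; [exact: leq_trans kn|rewrite lexx ler01].
apply: (etaT (cell eps)) => //; first exact: cell_convex.
  by move=> x; exact: cell_cylinder.
by apply: hD => x /Cs; exact: cell_cylinder.
Qed.

Lemma cylinder_neq0 x : cylinder x -> x.1 != 0.
Proof.
move=> [x1 _]; apply/eqP => x0; move: x1; rewrite /= /l1norm x0.
rewrite big1 => [/esym/eqP|i _]; first by rewrite oner_eq0.
by rewrite mxE normr0.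
Qed.


Lemma vertexN b k : - vertex b k = vertex (~~ b) k.
Proof. by rewrite /vertex -scaleNr; case: b; rewrite /= ?expr0 ?expr1 ?opprK. Qed.

(** Otherwise f has no common zero on the sphere, and the cochain of f, constant
    along the cylinder, is 1 on the (n-1)-sphere by [sphere_parity]; but its
    facets have n > m vertices, where the cochain vanishes. *)
Theorem borsuk_ulam (m : nat) (f : nat -> W -> R) : (m < n)%N ->
    (forall i, (i < m)%N -> continuous (f i)) ->
    (forall i x, (i < m)%N -> f i (- x) = - f i x) ->
  exists2 x, x != 0 & forall i, (i < m)%N -> f i x = 0.
Proof.
move=> mn cf fodd; apply: contrapT => no_zero.
have f0 x : cylinder x -> exists2 i, (i < m)%N & f i x.1 != 0.
  move=> /cylinder_neq0 x0; apply: contrapT => fx0; apply: no_zero.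
  exists x.1 => // i im; apply/eqP/negPn/negP => fi.
  by apply: fx0; exists i.
have [|i x im|//|eta [eta0 etaS _ etaT]] := @cylinder_antipodal_cochain m (fun i x => f i x.1).
- by move=> i im x; apply: (continuous_comp (g := f i)); [exact: cvg_fst|exact: cf].
- exact: fodd.
pose e0 := eta \o map (pair^~ 0).
have : sphere vertex n e0 = true.
  apply: (@sphere_parity _ vertex -%R vertexN n) => //; last by rewrite leqnn.
  move=> eps k kn s; rewrite /e0 -coboundary_map (etaT eps k _ kn).
  - rewrite size_map; congr (_ (+) eta _ (+) _); rewrite /= -!map_comp.
    exact: eq_map.
  - by rewrite size_map size_frame leqW.
  - by move=> x xs; rewrite mem_cat xs.
rewrite (@eq_sphere _ _ _ _ (fun=> false)) => [|eps]; last first.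
  by apply: etaS; rewrite size_map size_frame.
by rewrite sphere0.
Qed.

Definition reflect_last (x : W) : W :=
  \row_j (if j == ord_max then - x 0 j else x 0 j).

(** The map (v, s) |-> (E v, s + 1) is affine and preserves f, hence the cochain of
    f; it carries the bottom of the cylinder to the top, which is the situation of
    [no_twist]. *)
Theorem no_reflected_odd_family (f : nat -> V -> R) :
    (forall i, (i < n)%N -> continuous (f i)) ->
    (forall i x, (i < n)%N -> f i (- x.1, x.2) = - f i x) ->
    (forall x, x.1 != 0 -> exists2 i, (i < n)%N & f i x != 0) ->
    (forall i x, (i < n)%N -> f i (reflect_last x.1, x.2 + 1) = f i x) ->
  False.
Proof.
move=> cf fodd f0 fE.
have [||x /cylinder_neq0|eta [eta0 etaS etaI etaT]] := @cylinder_antipodal_cochain n f => //.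
  exact: f0.
have reflE b i : reflect_last (vertex b i) =
    if inord i == ord_max :> 'I_n then vertex (~~ b) i else vertex b i.
  apply/rowP => j; rewrite -vertexN /reflect_last mxE (fun_if (fun z : W => z 0 j)).
  have -> : vertex b i 0 j = (-1) ^+ (~~ b) * (j == inord i)%:R by rewrite !mxE.
  have -> : (- vertex b i) 0 j = - ((-1) ^+ (~~ b) * (j == inord i)%:R).
    by rewrite !mxE.
  have [->//|_] := eqVneq j (inord i).
  by rewrite mulr0 oppr0; case: ifP; case: ifP.
apply: (@no_twist _ _ (pair^~ 0 : W -> V) (pair^~ 1) vertex -%R reflect_last
  (fun x => (- x.1, x.2)) N eta vertexN) => //.
- move=> b i iN; rewrite reflE; case: eqP => // /(congr1 val) /=.
  by rewrite inordK ?leqW// => iN'; rewrite iN' ltnn in iN.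
- move=> b; rewrite reflE; case: eqP => // -[]; apply: val_inj.
  by rewrite /= inordK.
- move=> s; rewrite -[RHS](etaI (fun x => (reflect_last x.1, x.2 + 1))) //.
    by rewrite -!map_comp; congr eta; apply: eq_map => x /=; rewrite add0r.
  move=> x y c; congr pair; last first.
    have shift (a b : R) :
      c * a + (1 - c) * b + 1 = c * (a + 1) + (1 - c) * (b + 1) by ring.
    exact: shift.
  by apply/rowP => j; rewrite !mxE; case: ifP => _; ring.
Qed.

End CrossPolytope.

(** * Conjugacy and fundamental domains *)

(** Conjugacy between maps of possibly different spaces; for one space it is
    literally [topologically_conjugate]. *)
Definition conjugate (T U : topologicalType) (f : T -> T) (g : U -> U) : Prop :=
  exists (h : U -> T) (hinv : T -> U),
    [/\ continuous h, continuous hinv, cancel h hinv, cancel hinv h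
      & g =1 hinv \o f \o h].

Section Conjugacy.
Implicit Types T U W : topologicalType.

Lemma conjugateP T U (f : T -> T) (g : U -> U) : conjugate f g <->
  exists (h : U -> T) (hinv : T -> U),
    [/\ continuous h, continuous hinv, cancel h hinv, cancel hinv h
      & forall x, h (g x) = f (h x)].
Proof.
split=> -[h [k [ch ck hk kh e]]]; exists h, k; split=> // x.
  by rewrite e /= kh.
by rewrite /= -e hk.
Qed.

Lemma conjugate_refl T (f : T -> T) : conjugate f f.
Proof. by exists id, id; split=> // x; exact: cvg_id. Qed.

Lemma conjugate_sym T U (f : T -> T) (g : U -> U) : conjugate f g -> conjugate g f.
Proof.
move=> /conjugateP[h [k [ch ck hk kh e]]]; exists k, h; split=> // x.
by rewrite /= e kh.
Qed.

Lemma conjugate_trans T U W (f : T -> T) (g : U -> U) (l : W -> W) :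
  conjugate f g -> conjugate g l -> conjugate f l.
Proof.
move=> [h [k [ch ck hk kh e]]] [h' [k' [ch' ck' hk' kh' e']]].
exists (h \o h'), (k' \o k); split.
- by move=> x; apply: continuous_comp; [exact: ch'|exact: ch].
- by move=> x; apply: continuous_comp; [exact: ck|exact: ck'].
- exact: can_comp.
- exact: can_comp.
- by move=> x; rewrite e' /= e.
Qed.

Lemma conjugate_prod T U T' U' (f : T -> T) (g : U -> U) (f' : T' -> T')
    (g' : U' -> U') : conjugate f f' -> conjugate g g' ->
  conjugate (fun x : T * U => (f x.1, g x.2)) (fun x : T' * U' => (f' x.1, g' x.2)).
Proof.
move=> [h [k [ch ck hk kh e]]] [h' [k' [ch' ck' hk' kh' e']]].
exists (fun x => (h x.1, h' x.2)), (fun x => (k x.1, k' x.2)); split.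
- move=> x; apply: cvg_pair.
    by apply: (continuous_comp (g := h)); [exact: cvg_fst|exact: ch].
  by apply: (continuous_comp (g := h')); [exact: cvg_snd|exact: ch'].
- move=> x; apply: cvg_pair.
    by apply: (continuous_comp (g := k)); [exact: cvg_fst|exact: ck].
  by apply: (continuous_comp (g := k')); [exact: cvg_snd|exact: ck'].
- by move=> [x y] /=; rewrite hk hk'.
- by move=> [x y] /=; rewrite kh kh'.
- by move=> [x y] /=; rewrite e e'.
Qed.

Lemma fixed_point_conjugate T U (f : T -> T) (g : U -> U) :
  conjugate f g -> has_fixed_point f -> has_fixed_point g.
Proof. by move=> [h [k [_ _ hk kh e]]] [x fx]; exists (k x); rewrite e /= kh fx. Qed.

End Conjugacy.

Section FundamentalDomain.
Variables (R : realType) (X : topologicalType).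

Definition int_iter (f finv : X -> X) (k : int) : X -> X :=
  match k with Posz n => iter n f | Negz n => iter n.+1 finv end.

Section Iterates.
Variables f finv : X -> X.
Hypotheses (fK : cancel f finv) (finvK : cancel finv f).

Lemma iter_can n : cancel (iter n finv) (iter n f).
Proof. by elim: n => // n IH x; rewrite [LHS]iterSr iterS finvK IH. Qed.

Lemma int_iterS k x : int_iter f finv (k + 1) x = f (int_iter f finv k x).
Proof.
case: k => [n|[|n]]; first by rewrite -PoszD addn1.
  by rewrite /= finvK.
have -> : Negz n.+1 + 1 = Negz n.
  by rewrite !NegzE -[in LHS]addn1 PoszD opprD addrNK.
by rewrite /= finvK.
Qed.

Lemma int_iterSr k x : int_iter f finv (k + 1) x = int_iter f finv k (f x).
Proof.
case: k => [n|[|n]]; first by rewrite -PoszD addn1 /= -iterS iterSr.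
  by rewrite /= fK.
have -> : Negz n.+1 + 1 = Negz n.
  by rewrite !NegzE -[in LHS]addn1 PoszD opprD addrNK.
by rewrite /int_iter [in RHS]iterSr fK.
Qed.

End Iterates.

Lemma int_iterN f finv k x : cancel f finv -> cancel finv f ->
  int_iter f finv k (int_iter f finv (- k) x) = x.
Proof.
move=> fK finvK; case: k => [[|n]|n] //.
  exact: (iter_can finvK n.+1).
exact: (iter_can fK n.+1).
Qed.

Lemma iter_continuous (f : X -> X) n : continuous f -> continuous (iter n f).
Proof.
move=> cf; elim: n => [|n IH] x /=; first exact: cvg_id.
by apply: continuous_comp; [exact: IH|exact: cf].
Qed.

Lemma int_iter_continuous (f finv : X -> X) k : continuous f -> continuous finv ->
  continuous (int_iter f finv k).
Proof. by move=> cf cfinv; case: k => n; exact: iter_continuous. Qed.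

Variable phi : X -> R.
Hypothesis phi_cont : continuous phi.

Definition piece (f finv g ginv H : X -> X) (k : int) x :=
  int_iter f finv k (H (int_iter g ginv (- k) x)).

(** The candidate conjugacy extending H from the fundamental domain 0 <= phi < 1:
    x is moved there by a power of g, and back by the same power of f. *)
Definition unroll f finv g ginv H x := piece f finv g ginv H (Num.floor (phi x)) x.

Lemma phi_iter g ginv k x : cancel g ginv -> cancel ginv g ->
  (forall y, phi (g y) = phi y + 1) -> phi (int_iter g ginv k x) = phi x + k%:~R.
Proof.
move=> gK ginvK phig.
have pos n : phi (iter n g x) = phi x + n%:R.
  by elim: n => [|n IH]; rewrite ?addr0//= phig IH -natr1 addrA.
have neg n : phi (iter n ginv x) = phi x - n%:R.
  elim: n => [|n IH]; rewrite ?subr0//=.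
  by rewrite -[LHS](addrK 1) -phig ginvK IH -natr1 opprD addrA.
by case: k => n; [exact: pos|rewrite NegzE mulrNz; exact: neg].
Qed.

Lemma floorD1 (t : R) : Num.floor (t + 1) = Num.floor t + 1.
Proof.
apply: floor_def; have /andP[h1 h2] := floor_itv t.
by rewrite [(_ + 1 + 1)%:~R]intrD ltrD2r h2 andbT intrD lerD2r.
Qed.

Lemma unroll_shift f finv g ginv H x : cancel f finv -> cancel finv f ->
    cancel g ginv -> cancel ginv g -> (forall y, phi (g y) = phi y + 1) ->
  unroll f finv g ginv H (g x) = f (unroll f finv g ginv H x).
Proof.
move=> fK finvK gK ginvK phig; rewrite /unroll /piece phig floorD1.
rewrite int_iterS//; congr (f (int_iter f finv _ (H _))).
by rewrite -int_iterSr// opprD addrNK.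
Qed.

Lemma unroll_cancel f finv g ginv H Hinv : cancel f finv -> cancel finv f ->
    cancel g ginv -> cancel ginv g -> cancel H Hinv ->
    (forall y, phi (f y) = phi y + 1) -> (forall y, phi (g y) = phi y + 1) ->
    (forall y, phi (H y) = phi y) ->
  cancel (unroll f finv g ginv H) (unroll g ginv f finv Hinv).
Proof.
move=> fK finvK gK ginvK HK phif phig phiH x.
have phiu : phi (unroll f finv g ginv H x) = phi x.
  by rewrite /unroll /piece !(phi_iter, phiH)// mulrNz addrNK.
rewrite {1}/unroll phiu /unroll /piece.
set k := Num.floor (phi x).
have -> y : int_iter f finv (- k) (int_iter f finv k y) = y.
  by rewrite -[in X in int_iter _ _ (- k) X](opprK k) int_iterN.
by rewrite HK int_iterN.
Qed.

(** Near x only the pieces with index floor (phi x) and, when phi x is an integer,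
    the preceding one occur; the hypothesis on H at phi = 0 makes them agree at x. *)
Lemma unroll_continuous f finv g ginv H : cancel f finv -> cancel finv f ->
    cancel g ginv -> cancel ginv g -> (forall y, phi (g y) = phi y + 1) ->
    continuous f -> continuous finv -> continuous g -> continuous ginv ->
    continuous H -> (forall x, phi x = 0 -> H (g x) = f (H x)) ->
  continuous (unroll f finv g ginv H).
Proof.
move=> fK finvK gK ginvK phig cf cfi cg cgi cH Hgf x.
pose p := piece f finv g ginv H; set k := Num.floor (phi x).
have cp j : continuous (p j).
  move=> y; apply: (continuous_comp (f := int_iter g ginv (- j))
    (g := int_iter f finv j \o H)).
    exact: int_iter_continuous.
  apply: continuous_comp; first exact: cH.
  exact: int_iter_continuous.
have /andP[kx xk] := floor_itv (phi x); rewrite -/k in kx xk.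
move=> A nA; change (nbhs x (unroll f finv g ginv H @^-1` A)%classic).
have nA0 : nbhs x (p k @^-1` A)%classic by exact: cp.
have near_lt : nbhs x [set t | phi t < (k + 1)%:~R]%classic.
  exact: (cvgr_lt (phi x)) (phi_cont (x := x)) _ xk.
have near_gt s : s < phi x -> nbhs x [set t | s < phi t]%classic.
  exact: (cvgr_gt (phi x)) (phi_cont (x := x)) s.
have [xk0|xk0] := eqVneq (phi x) k%:~R.
  have pk : p (k - 1) x = p k x.
    rewrite -[k in RHS](subrK 1) /p /piece int_iterSr// -Hgf.
      by rewrite -int_iterS// opprD addrNK.
    by rewrite phi_iter// subrK xk0 mulrNz subrr.
  have k1x : (k - 1)%:~R < phi x by rewrite xk0 ltr_int ltrBlDr ltrDl.
  have nA1 : nbhs x (p (k - 1) @^-1` A)%classic.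
    by apply: (cp (k - 1) x A); rewrite pk.
  apply: (@filterS3 _ (nbhs x) _ _ _ _ _ _ nA0 nA1 (filterI near_lt (near_gt _ k1x))).
  move=> y /= Ak Ak1 [ltk gtk]; rewrite /unroll -/p.
  have [ky|yk] := lerP k%:~R (phi y).
    by rewrite (_ : Num.floor _ = k)//; apply: floor_def; rewrite ky.
  rewrite (_ : Num.floor _ = k - 1)//; apply: floor_def.
  by rewrite subrK yk ltW.
have kx' : k%:~R < phi x by rewrite lt_neqAle eq_sym xk0.
apply: (@filterS3 _ (nbhs x) _ _ _ _ _ _ nA0 near_lt (near_gt _ kx')) => y /= Ak ltk gtk.
by rewrite /unroll (_ : Num.floor _ = k)//; apply: floor_def; rewrite ltk ltW.
Qed.

(** The extension of Hinv, with f and g exchanged, is the inverse of the extension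
    of H. *)
Theorem conjugate_fundamental_domain f finv g ginv H Hinv :
    cancel f finv -> cancel finv f -> cancel g ginv -> cancel ginv g ->
    cancel H Hinv -> cancel Hinv H ->
    continuous f -> continuous finv -> continuous g -> continuous ginv ->
    continuous H -> continuous Hinv ->
    (forall y, phi (f y) = phi y + 1) -> (forall y, phi (g y) = phi y + 1) ->
    (forall y, phi (H y) = phi y) -> (forall x, phi x = 0 -> H (g x) = f (H x)) ->
  conjugate f g.
Proof.
move=> fK finvK gK ginvK HK HinvK cf cfi cg cgi cH cHi phif phig phiH Hgf.
have phiHi y : phi (Hinv y) = phi y by rewrite -{2}[y]HinvK phiH.
apply/conjugateP; exists (unroll f finv g ginv H), (unroll g ginv f finv Hinv); split.
- exact: unroll_continuous.
- apply: unroll_continuous => // x x0; apply: (can_inj HK).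
  by rewrite HinvK Hgf ?HinvK// phiHi.
- exact: unroll_cancel.
- exact: unroll_cancel.
- by move=> x; exact: unroll_shift.
Qed.

End FundamentalDomain.

(** * Continuity and paths of matrices *)

Lemma continuous_pair (T U W : topologicalType) (f : T -> U) (g : T -> W) :
  continuous f -> continuous g -> continuous (fun x => (f x, g x)).
Proof. by move=> cf cg x; apply: cvg_pair; [exact: cf|exact: cg]. Qed.

Lemma continuous_compose (T U W : topologicalType) (f : T -> U) (g : U -> W) :
  continuous f -> continuous g -> continuous (fun x => g (f x)).
Proof. by move=> cf cg x; apply: continuous_comp; [exact: cf|exact: cg]. Qed.

Section MatrixContinuity.
Variables (K : numFieldType) (T : topologicalType).

Lemma continuous_matrix m n (F : T -> 'M[K]_(m, n)) :
  (forall i j, continuous (fun x => F x i j)) -> continuous F.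
Proof.
move=> cF x A [P nP PA].
have nQ : nbhs x [set y | forall ij : 'I_m * 'I_n, P ij.1 ij.2 (F y ij.1 ij.2)]%classic.
  by apply: filter_forall => -[i j] /=; exact: (cF i j x (P i j) (nP i j)).
by apply: filterS nQ => y hy; apply: PA => i j; exact: (hy (i, j)).
Qed.

Lemma continuous_entry m n (F : T -> 'M[K]_(m, n)) i j :
  continuous F -> continuous (fun x => F x i j).
Proof.
move=> cF x; apply: (continuous_comp (g := fun M : 'M[K]_(m, n) => M i j)).
  exact: cF.
exact: coord_continuous.
Qed.

Lemma continuous_add (f g : T -> K) : continuous f -> continuous g ->
  continuous (fun x => f x + g x).
Proof. by move=> cf cg x; apply: cvgD; [exact: cf|exact: cg]. Qed.

Lemma continuous_opp (f : T -> K) : continuous f -> continuous (fun x => - f x).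
Proof. by move=> cf x; apply: cvgN; exact: cf. Qed.

Lemma continuous_mul (f g : T -> K) : continuous f -> continuous g ->
  continuous (fun x => f x * g x).
Proof. by move=> cf cg x; apply: cvgM; [exact: cf|exact: cg]. Qed.

Lemma continuous_addmx m n (F G : T -> 'M[K]_(m, n)) :
  continuous F -> continuous G -> continuous (fun x => F x + G x).
Proof.
move=> cF cG; apply: continuous_matrix => i j.
have -> : (fun x => (F x + G x) i j) = (fun x => F x i j + G x i j).
  by apply/funext => x; rewrite mxE.
by apply: continuous_add; exact: continuous_entry.
Qed.

Lemma continuous_oppmx m n (F : T -> 'M[K]_(m, n)) :
  continuous F -> continuous (fun x => - F x).
Proof.
move=> cF; apply: continuous_matrix => i j.
have -> : (fun x => (- F x) i j) = (fun x => - F x i j).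
  by apply/funext => x; rewrite mxE.
by apply: continuous_opp; exact: continuous_entry.
Qed.

Lemma continuous_mulmx m n p (F : T -> 'M[K]_(m, n)) (G : T -> 'M[K]_(n, p)) :
  continuous F -> continuous G -> continuous (fun x => F x *m G x).
Proof.
move=> cF cG; apply: continuous_matrix => i j.
have -> : (fun x => (F x *m G x) i j) = (fun x => \sum_k F x i k * G x k j).
  by apply/funext => x; rewrite mxE.
apply: continuous_big => [|k _]; first exact: add_continuous.
by apply: continuous_mul; exact: continuous_entry.
Qed.

Lemma continuous_scalemx m n (f : T -> K) (G : T -> 'M[K]_(m, n)) :
  continuous f -> continuous G -> continuous (fun x => f x *: G x).
Proof.
move=> cf cG; apply: continuous_matrix => i j.
have -> : (fun x => (f x *: G x) i j) = (fun x => f x * G x i j).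
  by apply/funext => x; rewrite mxE.
by apply: continuous_mul => //; exact: continuous_entry.
Qed.

Lemma continuous_cstmx m n (A : 'M[K]_(m, n)) : continuous (fun _ : T => A).
Proof. by move=> x; exact: cvg_cst. Qed.

Lemma continuous_scalar_mx n (f : T -> K) :
  continuous f -> continuous (fun x => (f x)%:M : 'M[K]_n).
Proof.
move=> cf; have -> : (fun x => (f x)%:M : 'M[K]_n) = (fun x => f x *: 1%:M).
  by apply/funext => x; rewrite scalemx1.
by apply: continuous_scalemx => //; exact: continuous_cstmx.
Qed.

Lemma continuous_col_mx m1 m2 n (F : T -> 'M[K]_(m1, n)) (G : T -> 'M[K]_(m2, n)) :
  continuous F -> continuous G -> continuous (fun x => col_mx (F x) (G x)).
Proof.
move=> cF cG; apply: continuous_matrix => i j.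
have [k ik|k ik] := split_ordP i.
  have -> : (fun x => col_mx (F x) (G x) i j) = (fun x => F x k j).
    by apply/funext => x; rewrite ik col_mxEu.
  exact: continuous_entry.
have -> : (fun x => col_mx (F x) (G x) i j) = (fun x => G x k j).
  by apply/funext => x; rewrite ik col_mxEd.
exact: continuous_entry.
Qed.

Lemma continuous_trmx m n (F : T -> 'M[K]_(m, n)) :
  continuous F -> continuous (fun x => (F x)^T).
Proof.
move=> cF; apply: continuous_matrix => i j.
have -> : (fun x => (F x)^T i j) = (fun x => F x j i).
  by apply/funext => x; rewrite mxE.
exact: continuous_entry.
Qed.

Lemma continuous_row_mx m n1 n2 (F : T -> 'M[K]_(m, n1)) (G : T -> 'M[K]_(m, n2)) :
  continuous F -> continuous G -> continuous (fun x => row_mx (F x) (G x)).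
Proof.
move=> cF cG.
have -> : (fun x => row_mx (F x) (G x)) = (fun x => (col_mx (F x)^T (G x)^T)^T).
  by apply/funext => x; rewrite tr_col_mx !trmxK.
by apply/continuous_trmx/continuous_col_mx; exact: continuous_trmx.
Qed.

Lemma continuous_block_mx m1 m2 n1 n2 (A : T -> 'M[K]_(m1, n1))
    (B : T -> 'M[K]_(m1, n2)) (C : T -> 'M[K]_(m2, n1)) (D : T -> 'M[K]_(m2, n2)) :
  continuous A -> continuous B -> continuous C -> continuous D ->
  continuous (fun x => block_mx (A x) (B x) (C x) (D x)).
Proof.
by move=> cA cB cC cD; apply: continuous_col_mx; exact: continuous_row_mx.
Qed.

Lemma continuous_usubmx m1 m2 n (F : T -> 'M[K]_(m1 + m2, n)) :
  continuous F -> continuous (fun x => usubmx (F x)).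
Proof.
move=> cF; apply: continuous_matrix => i j.
have -> : (fun x => usubmx (F x) i j) = (fun x => F x (lshift m2 i) j).
  by apply/funext => x; rewrite mxE.
exact: continuous_entry.
Qed.

Lemma continuous_dsubmx m1 m2 n (F : T -> 'M[K]_(m1 + m2, n)) :
  continuous F -> continuous (fun x => dsubmx (F x)).
Proof.
move=> cF; apply: continuous_matrix => i j.
have -> : (fun x => dsubmx (F x) i j) = (fun x => F x (rshift m1 i) j).
  by apply/funext => x; rewrite mxE.
exact: continuous_entry.
Qed.

End MatrixContinuity.

Section Paths.
Variables (R : realType) (K : numFieldType) (iota : R -> K).
Hypotheses (iota_cont : continuous iota) (iota0 : iota 0 = 0) (iota1 : iota 1 = 1).

Definition scalar_path (d : K) :=
  exists c : R -> K, [/\ continuous c, (forall t, c t != 0), c 0 = 1 & c 1 = d].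

(** The inverse matrices are part of the data, which makes their continuity
    immediate. *)
Definition matrix_path n (M : 'M[K]_n) :=
  exists P Q : R -> 'M[K]_n, [/\ continuous P, continuous Q,
    (forall t, P t *m Q t = 1%:M), P 0 = 1%:M & P 1 = M].

Lemma matrix_path_mul n (M M' : 'M[K]_n) :
  matrix_path M -> matrix_path M' -> matrix_path (M *m M').
Proof.
move=> [P [Q [cP cQ PQ P0 P1]]] [P' [Q' [cP' cQ' PQ' P0' P1']]].
exists (fun t => P t *m P' t), (fun t => Q' t *m Q t); split.
- exact: continuous_mulmx.
- exact: continuous_mulmx.
- by move=> t; rewrite mulmxA -(mulmxA (P t)) PQ' mulmx1.
- by rewrite P0 P0' mulmx1.
- by rewrite P1 P1'.
Qed.

Lemma matrix_path_inv n (M : 'M[K]_n) : matrix_path M -> matrix_path (invmx M).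
Proof.
move=> [P [Q [cP cQ PQ P0 P1]]]; exists Q, P; split=> //.
- by move=> t; apply: mulmx1C.
- by have := PQ 0; rewrite P0 mul1mx.
- have PQ1 := PQ 1; rewrite P1 in PQ1.
  have [Mu _] := mulmx1_unit PQ1.
  by rewrite -[LHS]mul1mx -(mulVmx Mu) -mulmxA PQ1 mulmx1.
Qed.

Lemma matrix_path_unit n (M : 'M[K]_n) : matrix_path M -> M \in unitmx.
Proof.
move=> [P [Q [_ _ PQ _ P1]]]; have := PQ 1; rewrite P1 => PQ1.
by have [] := mulmx1_unit PQ1.
Qed.

Lemma matrix_path_cancel n (U M : 'M[K]_n) :
  matrix_path U -> matrix_path (U *m M) -> matrix_path M.
Proof.
move=> pU pUM; rewrite -[M]mul1mx -(mulVmx (matrix_path_unit pU)) -mulmxA.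
exact: matrix_path_mul (matrix_path_inv pU) pUM.
Qed.

Lemma matrix_path_block m n (M : 'M[K]_n) : matrix_path M ->
  matrix_path (block_mx 1%:M 0 0 M : 'M[K]_(m + n)).
Proof.
move=> [P [Q [cP cQ PQ P0 P1]]].
exists (fun t => block_mx 1%:M 0 0 (P t)), (fun t => block_mx 1%:M 0 0 (Q t)); split.
- by apply: continuous_block_mx => //; exact: continuous_cstmx.
- by apply: continuous_block_mx => //; exact: continuous_cstmx.
- move=> t; rewrite mulmx_block !mul0mx !mulmx0 PQ mulmx1 !addr0 add0r.
  by rewrite -scalar_mx_block.
- by rewrite P0 -scalar_mx_block.
- by rewrite P1.
Qed.

Lemma matrix_path_lower m n (v : 'M[K]_(n, m)) :
  matrix_path (block_mx 1%:M 0 v 1%:M : 'M[K]_(m + n)).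
Proof.
exists (fun t => block_mx 1%:M 0 (iota t *: v) 1%:M),
  (fun t => block_mx 1%:M 0 (- (iota t *: v)) 1%:M); split.
- apply: continuous_block_mx; try exact: continuous_cstmx.
  by apply: continuous_scalemx => //; exact: continuous_cstmx.
- apply: continuous_block_mx; try exact: continuous_cstmx.
  by apply/continuous_oppmx/continuous_scalemx => //; exact: continuous_cstmx.
- move=> t; rewrite mulmx_block !mul0mx !mulmx0 !mulmx1 !mul1mx !addr0 add0r.
  by rewrite subrr -scalar_mx_block.
- by rewrite iota0 scale0r -scalar_mx_block.
- by rewrite iota1 scale1r.
Qed.

Lemma matrix_path_upper m n (v : 'M[K]_(m, n)) :
  matrix_path (block_mx 1%:M v 0 1%:M : 'M[K]_(m + n)).
Proof.
exists (fun t => block_mx 1%:M (iota t *: v) 0 1%:M),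
  (fun t => block_mx 1%:M (- (iota t *: v)) 0 1%:M); split.
- apply: continuous_block_mx; try exact: continuous_cstmx.
  by apply: continuous_scalemx => //; exact: continuous_cstmx.
- apply: continuous_block_mx; try exact: continuous_cstmx.
  by apply/continuous_oppmx/continuous_scalemx => //; exact: continuous_cstmx.
- move=> t; rewrite mulmx_block !mul0mx !mulmx0 !mulmx1 !mul1mx !addr0 add0r.
  by rewrite addrC subrr -scalar_mx_block.
- by rewrite iota0 scale0r -scalar_mx_block.
- by rewrite iota1 scale1r.
Qed.

Lemma scalar_path_neq0 d : scalar_path d -> d != 0.
Proof. by move=> [c [_ c0 _ <-]]. Qed.

(** Unitriangular block matrices are joined to 1 by straight segments, so modulo
    paths M can be modified by elementary operations. Gauss elimination in the
    first row and column lowers the size without changing the determinant, down to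
    size 1. *)
Lemma det_matrix_path n (M : 'M[K]_n) : scalar_path (\det M) -> matrix_path M.
Proof.
case: n M => [|n] M.
  move=> _; exists (fun=> 1%:M), (fun=> 1%:M); split=> //; try exact: continuous_cstmx.
    by move=> t; rewrite mulmx1.
  by rewrite [RHS]flatmx0 flatmx0.
elim: n M => [|n IH] M pM.
  case: pM => c [cc c0 c1 cM].
  exists (fun t => (c t)%:M), (fun t => (c t)^-1%:M); split.
  - exact: continuous_scalar_mx.
  - apply: continuous_scalar_mx => t; apply: cvgV; [exact: c0|exact: cc].
  - by move=> t; rewrite -scalar_mxM mulfV.
  - by rewrite c1.
  - by rewrite cM [RHS]mx11_scalar det_mx11.
(* With corner entry 1, the rest of the first column, then of the first row, is cleared. *)
have corner1 (r : 'rV[K]_n.+1) (v : 'cV[K]_n.+1) (B : 'M[K]_n.+1) :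
    scalar_path (\det (block_mx (1%:M : 'M[K]_1) r v B)) ->
  matrix_path (block_mx (1%:M : 'M[K]_1) r v B).
  move=> pdet; apply: (matrix_path_cancel (matrix_path_lower (- v))).
  set B' := B - v *m r.
  have E : block_mx 1%:M 0 (- v) 1%:M *m block_mx (1%:M : 'M[K]_1) r v B =
      block_mx 1%:M r 0 B'.
    rewrite mulmx_block !mul0mx !mul1mx !mulmx1 !addr0 addNr mulNmx.
    by rewrite [_ + B]addrC.
  have -> : block_mx 1%:M 0 (- v) 1%:M *m block_mx (1%:M : 'M[K]_1) r v B =
      block_mx (1%:M : 'M[K]_1) 0 0 B' *m block_mx 1%:M r 0 1%:M.
    by rewrite E mulmx_block !mul0mx !mulmx0 !mul1mx !mulmx1 !addr0 add0r.
  apply: matrix_path_mul; last exact: matrix_path_upper.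
  apply: matrix_path_block; apply: IH.
  have := congr1 determinant E.
  by rewrite det_mulmx det_lblock det_ublock !det1 !mul1r => <-.
(* A nonzero entry below the corner is used to turn the corner into 1. *)
have below (a : 'M[K]_1) (r : 'rV[K]_n.+1) (v : 'cV[K]_n.+1) (B : 'M[K]_n.+1) : v != 0 ->
    scalar_path (\det (block_mx a r v B)) -> matrix_path (block_mx a r v B).
  move=> v0 pdet; have [i vi] : exists i, v i 0 != 0.
    by apply/existsP; apply: contraNT v0 => /existsPn vi; apply/eqP/colP => i;
      rewrite mxE; apply/eqP; have := vi i; rewrite negbK.
  pose u : 'rV[K]_n.+1 := ((1 - a 0 0) / v i 0) *: delta_mx 0 i.
  have uv : a + u *m v = 1%:M.
    rewrite [LHS]mx11_scalar !mxE (bigD1 i)//= big1 => [|j ji].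
      by rewrite !mxE !eqxx mulr1 addr0 divfK// addrC subrK.
    by rewrite !mxE eqxx (negbTE ji) mulr0 mul0r.
  apply: (matrix_path_cancel (matrix_path_upper u)).
  have E : block_mx 1%:M u 0 1%:M *m block_mx a r v B =
      block_mx 1%:M (r + u *m B) v B.
    by rewrite mulmx_block !mul1mx !mul0mx !add0r uv.
  rewrite E; apply: corner1; rewrite -E det_mulmx det_ublock !det1 !mul1r.
  exact: pdet.
move: pM; rewrite -(submxK (M : 'M[K]_(1 + n.+1))).
move: (ulsubmx _) (ursubmx _) (dlsubmx _) (drsubmx _) => a r v B pM.
have [v0|] := eqVneq v 0; last by move=> v0; exact: below.
have a0 : a 0 0 != 0.
  have := scalar_path_neq0 pM; rewrite v0 (det_ublock a r B) det_mx11.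
  by apply: contraNneq => ->; rewrite mul0r.
(* The first column is zero below a nonzero corner; adding the first row to
   the others changes this. *)
pose w : 'cV[K]_n.+1 := const_mx 1.
apply: (matrix_path_cancel (matrix_path_lower w)).
have E : block_mx 1%:M 0 w 1%:M *m block_mx a r v B =
    block_mx a r (w *m a) (w *m r + B).
  by rewrite mulmx_block !mul1mx !mul0mx !addr0 v0 addr0.
rewrite E; apply: below.
  apply: contraNneq a0 => /(congr1 (fun z : 'cV[K]_n.+1 => z 0 0)).
  by rewrite !mxE big_ord1 mxE mul1r => ->.
by rewrite -E det_mulmx det_lblock !det1 !mul1r.
Qed.

End Paths.

(** * Affine bijections without fixed points *)

Section AffineConjugacy.
Variable K : numFieldType.

Lemma conjugate_similar n (U A A' : 'M[K]_n) b b' : U \in unitmx ->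
  U *m A = A' *m U -> U *m b = b' -> conjugate (affine A b) (affine A' b').
Proof.
move=> Uu UA Ub; apply: conjugate_sym; apply/conjugateP.
have cmul (M : 'M[K]_n) : continuous (fun x : 'cV[K]_n => M *m x).
  by apply: continuous_mulmx; [exact: continuous_cstmx|move=> x; exact: cvg_id].
exists (mulmx U), (mulmx (invmx U)); split.
- exact: cmul.
- exact: cmul.
- by move=> x; rewrite mulKmx.
- by move=> x; rewrite mulKVmx.
- by move=> x; rewrite /affine mulmxDr Ub !mulmxA UA.
Qed.

Lemma conjugate_translation n (A : 'M[K]_n) b x0 : affine A b x0 = x0 ->
  conjugate (affine A b) (fun x : 'cV[K]_n => A *m x).
Proof.
move=> fx0; apply/conjugateP; exists (fun x : 'cV[K]_n => x + x0), (fun x : 'cV[K]_n => x - x0).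
have cadd (v : 'cV[K]_n) : continuous (fun x : 'cV[K]_n => x + v).
  by apply: continuous_addmx; [move=> x; exact: cvg_id|exact: continuous_cstmx].
split.
- exact: cadd.
- exact: cadd.
- by move=> x; rewrite addrK.
- by move=> x; rewrite subrK.
- by move=> x; rewrite -{1}fx0 /affine mulmxDr addrA.
Qed.

Lemma conjugate_split p q (A : 'M[K]_p) (C : 'M[K]_q) b d :
  conjugate (affine (block_mx A 0 0 C) (col_mx b d))
    (fun x : 'cV[K]_p * 'cV[K]_q => (affine A b x.1, affine C d x.2)).
Proof.
apply/conjugateP; exists (fun x => col_mx x.1 x.2), (fun x => (usubmx x, dsubmx x)).
split.
- by apply: continuous_col_mx => x; [exact: cvg_fst|exact: cvg_snd].
- have cid : continuous (@id 'cV[K]_(p + q)) by move=> x; exact: cvg_id.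
  apply: continuous_pair; first exact: (continuous_usubmx cid).
  exact: (continuous_dsubmx cid).
- by move=> [x y] /=; rewrite col_mxKu col_mxKd.
- by move=> x /=; rewrite vsubmxK.
- move=> [x y]; rewrite /affine /= mul_block_col !mul0mx addr0 add0r.
  by rewrite add_col_mx.
Qed.

(** No fixed point means that b is not in the image of A - 1, so some functional
    kills this image but not b. *)
Lemma no_fixed_point_functional n (A : 'M[K]_n) b :
    ~ has_fixed_point (affine A b) ->
  exists w : 'rV[K]_n, w *m A = w /\ w *m b = 1%:M.
Proof.
move=> nofix; pose D := (A - 1%:M)^T.
have bD : ~~ (b^T <= D)%MS.
  apply/negP => /submxP[z bz]; apply: nofix; exists (- z^T).
  rewrite /affine -[b]trmxK bz trmx_mul trmxK mulmxBl mul1mx mulmxN.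
  by rewrite addrA addNr add0r.
have [j bj] : exists j, (b^T *m cokermx D) 0 j != 0.
  apply/existsP; apply: contraNT bD => /existsPn b0; rewrite submxE.
  by apply/eqP/rowP => j; have /negPn/eqP -> := b0 j; rewrite mxE.
pose w := (col j (cokermx D))^T.
have wD : w *m (A - 1%:M) = 0.
  by rewrite -[A - _]trmxK -trmx_mul -/D colE mulmxA mulmx_coker mul0mx trmx0.
have wb : w *m b = ((b^T *m cokermx D) 0 j)%:M.
  rewrite [LHS]mx11_scalar -[w *m b]trmxK trmx_mul trmxK colE mulmxA -colE.
  by congr (_%:M); rewrite mxE [LHS]mxE.
exists (((b^T *m cokermx D) 0 j)^-1 *: w); split.
  rewrite -scalemxAl; congr (_ *: _); apply/eqP.
  by rewrite -subr_eq0 -{2}[w]mulmx1 -mulmxBr wD.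
by rewrite -scalemxAl wb scale_scalar_mx mulVf.
Qed.

(** The vector w is a multiple of the first row of its extended row basis. *)
Lemma complete_functional m (w : 'rV[K]_m.+1) : w != 0 ->
  exists2 U : 'M[K]_m.+1, U \in unitmx & row 0 U = w.
Proof.
move=> w0; have rw : \rank w = 1%N.
  by apply/eqP; rewrite eqn_leq rank_leq_row lt0n mxrank_eq0.
pose k := col_ebase w 0 0.
have wE : w = k *: row 0 (row_ebase w).
  rewrite -{1}(mulmx_ebase w) rw [col_ebase w]mx11_scalar -/k.
  rewrite -mulmxA mul_scalar_mx; congr (_ *: _).
  apply/rowP => j; rewrite !mxE (bigD1 0)//= big1 => [|i i0].
    by rewrite !mxE mul1r addr0.
  rewrite !mxE; have -> : (0 == i :> nat) = false by rewrite eq_sym; exact: negbTE i0.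
  by rewrite mul0r.
have k0 : k != 0 by apply: contraNneq w0 => k0; rewrite wE k0 scale0r.
exists (k *: row_ebase w); first by rewrite unitmxZ ?unitfE// row_ebase_unit.
by rewrite [RHS]wE; apply/rowP => j; rewrite !mxE.
Qed.

End AffineConjugacy.

Section Shear.
Variables (R : realType) (K : numFieldType) (iota : R -> K) (re : K -> R).
Hypotheses (iota_cont : continuous iota) (iota0 : iota 0 = 0) (iota1 : iota 1 = 1).
Hypotheses (re_cont : continuous re) (reD1 : forall x, re (x + 1) = re x + 1).

(** The form taken by an affine bijection f in coordinates (t, y), where t is a
    functional with t (f x) = t x + 1. *)
Definition shear m (B : 'M[K]_m) (c d : 'cV[K]_m) (x : K * 'cV[K]_m) :=
  (x.1 + 1, B *m x.2 + x.1 *: c + d).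

Definition shear_inv m (B : 'M[K]_m) (c d : 'cV[K]_m) (x : K * 'cV[K]_m) :=
  (x.1 - 1, invmx B *m (x.2 - d - (x.1 - 1) *: c)).

Let cfst m : continuous (fun x : K * 'cV[K]_m => x.1).
Proof. by move=> x; exact: cvg_fst. Qed.

Let csnd m : continuous (fun x : K * 'cV[K]_m => x.2).
Proof. by move=> x; exact: cvg_snd. Qed.

Let ccst m (k : K) : continuous (fun x : K * 'cV[K]_m => k).
Proof. by move=> x; exact: cvg_cst. Qed.

Lemma continuous_shear m (B : 'M[K]_m) c d : continuous (shear B c d).
Proof.
apply: continuous_pair.
  by apply: continuous_add; [exact: cfst|exact: ccst].
apply: continuous_addmx; last exact: continuous_cstmx.
apply: continuous_addmx.
  by apply: continuous_mulmx; [exact: continuous_cstmx|exact: csnd].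
by apply: continuous_scalemx; [exact: cfst|exact: continuous_cstmx].
Qed.

Lemma continuous_shear_inv m (B : 'M[K]_m) c d : continuous (shear_inv B c d).
Proof.
have c1 : continuous (fun x : K * 'cV[K]_m => x.1 - 1).
  by apply: continuous_add; [exact: cfst|exact: ccst].
apply: continuous_pair; first exact: c1.
apply: continuous_mulmx; first exact: continuous_cstmx.
apply: continuous_addmx.
  by apply: continuous_addmx; [exact: csnd|exact: continuous_cstmx].
apply: continuous_oppmx.
by apply: continuous_scalemx; [exact: c1|exact: continuous_cstmx].
Qed.

Lemma shearK m (B : 'M[K]_m) c d : B \in unitmx -> cancel (shear B c d) (shear_inv B c d).
Proof. by move=> Bu [t y]; rewrite /shear /shear_inv /= !addrK mulKmx. Qed.

Lemma shear_invK m (B : 'M[K]_m) c d : B \in unitmx -> cancel (shear_inv B c d) (shear B c d).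
Proof. by move=> Bu [t y]; rewrite /shear /shear_inv /= subrK mulKVmx// !subrK. Qed.

(** The two shears differ by G (t, y) = (t, M y + t c0 + d0) with M = B B'^-1. A
    homeomorphism that is the identity where re t = 0 and G where re t = 1 is
    obtained from the path to M and by scaling the translation part by re t. *)
Lemma conjugate_shear m (B B' : 'M[K]_m) c d c' d' : B \in unitmx -> B' \in unitmx ->
  matrix_path R (B *m invmx B') -> conjugate (shear B c d) (shear B' c' d').
Proof.
move=> Bu B'u [P [Q [cP cQ PQ P0 P1]]]; set M := B *m invmx B' in P1.
have MB : M *m B' = B by rewrite /M mulmxKV.
pose c0 := c - M *m c'; pose d0 := d - M *m d' - c0.
have cE : c = M *m c' + c0 by rewrite addrC subrK.
have dE : d = M *m d' + (c0 + d0) by rewrite /d0 [c0 + _]addrC subrK addrC subrK.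
clearbody c0 d0.
pose u (t : K) : 'cV[K]_m := iota (re t) *: (t *: c0 + d0).
have QP t : Q t *m P t = 1%:M by exact: mulmx1C.
have cre : continuous (fun x : K * 'cV[K]_m => re x.1).
  by move=> x; apply: (continuous_comp (g := re)); [exact: cvg_fst|exact: re_cont].
have cu : continuous (fun x : K * 'cV[K]_m => u x.1).
  apply: continuous_scalemx.
    by move=> x; apply: (continuous_comp (g := iota)); [exact: cre|exact: iota_cont].
  apply: continuous_addmx; last exact: continuous_cstmx.
  by apply: continuous_scalemx; [exact: cfst|exact: continuous_cstmx].
apply: (@conjugate_fundamental_domain R _ (fun x => re x.1) cre _
  (shear_inv B c d) _ (shear_inv B' c' d')
  (fun x => (x.1, P (re x.1) *m x.2 + u x.1))
  (fun x => (x.1, Q (re x.1) *m (x.2 - u x.1)))).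
- exact: shearK.
- exact: shear_invK.
- exact: shearK.
- exact: shear_invK.
- by move=> [t y] /=; rewrite addrK mulmxA QP mul1mx.
- by move=> [t y] /=; rewrite mulmxA PQ mul1mx subrK.
- exact: continuous_shear.
- exact: continuous_shear_inv.
- exact: continuous_shear.
- exact: continuous_shear_inv.
- apply: continuous_pair; first exact: cfst.
  apply: continuous_addmx; last exact: cu.
  apply: continuous_mulmx; last exact: csnd.
  by move=> x; apply: (continuous_comp (g := P)); [exact: cre|exact: cP].
- apply: continuous_pair; first exact: cfst.
  apply: continuous_mulmx.
    by move=> x; apply: (continuous_comp (g := Q)); [exact: cre|exact: cQ].
  by apply: continuous_addmx; [exact: csnd|exact: continuous_oppmx].
- by move=> x; exact: reD1.
- by move=> x; exact: reD1.
- by [].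
- move=> [t y] /= t0; rewrite /shear /= reD1 t0 add0r P0 P1 mul1mx /u reD1 t0 add0r.
  rewrite iota0 iota1 scale0r addr0 scale1r; congr pair.
  rewrite !mulmxDr mulmxA MB -scalemxAr scalerDl scale1r -!addrA; congr (_ + _).
  by rewrite cE dE scalerDr -addrA; congr (_ + _); exact: addrCA.
Qed.

Lemma conjugate_affine_shear m (A : 'M[K]_m.+1) b : ~ has_fixed_point (affine A b) ->
  exists (B : 'M[K]_m) c d, \det B = \det A /\ conjugate (affine A b) (shear B c d).
Proof.
move=> /no_fixed_point_functional[w [wA wb]].
have w0 : w != 0.
  apply: contra_eq_neq wb => ->; rewrite mul0mx eq_sym.
  by rewrite -scalemx1 scale1r matrix_nonzero1.
have [U Uu U0] := complete_functional w0.
pose A' := U *m A *m invmx U; pose b' := U *m b.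
have A'0 : row 0 A' = row 0 1%:M.
  by rewrite /A' !row_mul U0 wA -U0 -row_mul mulmxV.
have b'0 : row 0 b' = 1%:M by rewrite row_mul U0.
have UA' : U *m A = A' *m U by rewrite /A' mulmxKV.
have Ub' : U *m b = b' by [].
have detA' : \det A' = \det A.
  by rewrite /A' !det_mulmx mulrAC -det_mulmx mulmxV// det1 mul1r.
clearbody A' b'; pose A2 : 'M[K]_(1 + m) := A'.
pose B := drsubmx A2; pose c := dlsubmx A2; pose d := dsubmx (b' : 'cV[K]_(1 + m)).
have A2E : A2 = block_mx 1%:M 0 c B.
  rewrite -[LHS]submxK -/c -/B; congr (block_mx _ _ _ _).
    apply/matrixP => i j; rewrite !ord1 !mxE.
    have := congr1 (fun z : 'rV_m.+1 => z 0 0) A'0; rewrite !mxE => <-.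
    by congr (A' _ _); exact: val_inj.
  apply/matrixP => i j; rewrite !ord1 !mxE.
  have := congr1 (fun z : 'rV_m.+1 => z 0 (rshift 1 j)) A'0; rewrite !mxE => Aj.
  by rewrite -[RHS]Aj; congr (A' _ _); exact: val_inj.
have b2E : (b' : 'cV[K]_(1 + m)) = col_mx 1%:M d.
  rewrite -[LHS](@vsubmxK _ 1 m 1) -/d; congr (col_mx _ _).
  by rewrite -b'0; apply/matrixP => i j; rewrite !mxE !ord1; congr (b' _ _);
    exact: val_inj.
exists B, c, d; split.
  by have := det_lblock (1%:M : 'M[K]_1) c B; rewrite -A2E det1 mul1r => <-.
apply: (@conjugate_trans _ _ _ _ (affine A' b')).
  exact: (conjugate_similar Uu).
apply/conjugateP.
exists (fun x : K * 'cV[K]_m => col_mx x.1%:M x.2 : 'cV[K]_(1 + m)),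
  (fun x : 'cV[K]_m.+1 => (x 0 0, dsubmx (x : 'cV[K]_(1 + m)))); split.
- apply: (@continuous_col_mx _ _ 1 m 1); last exact: csnd.
  by apply: continuous_scalar_mx; exact: cfst.
- apply: continuous_pair.
    by apply: continuous_entry => x; exact: cvg_id.
  by apply: (@continuous_dsubmx _ _ 1 m) => x; exact: cvg_id.
- move=> [t y]; rewrite /= (@col_mxKd _ 1 m); congr pair.
  have -> : (0 : 'I_m.+1) = lshift m (0 : 'I_1) by exact: val_inj.
  by rewrite (@col_mxEu _ 1 m 1) mxE.
- move=> x /=.
  have -> : (x 0 0)%:M = usubmx (x : 'cV[K]_(1 + m)).
    rewrite [RHS]mx11_scalar mxE; congr (x _ _)%:M; exact: val_inj.
  exact: (vsubmxK (x : 'cV[K]_(1 + m))).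
- move=> [t y]; rewrite /affine -/A2 b2E A2E (@mul_block_col _ 1 m 1 m).
  rewrite (@add_col_mx _ 1 m) /= mul0mx addr0 mul1mx mul_mx_scalar.
  by rewrite [t *: c + _]addrC -raddfD.
Qed.

Theorem conjugate_no_fixed_point n (A C : 'M[K]_n) b d :
    A \in unitmx -> C \in unitmx ->
    ~ has_fixed_point (affine A b) -> ~ has_fixed_point (affine C d) ->
    scalar_path R (\det A / \det C) ->
  conjugate (affine A b) (affine C d).
Proof.
case: n A C b d => [|m] A C b d Au Cu fixA fixC pdet.
  by case: fixA; exists 0; apply/colP => -[].
have [B [c [e [detB cB]]]] := conjugate_affine_shear fixA.
have [D [c' [e' [detD cD]]]] := conjugate_affine_shear fixC.
apply: (conjugate_trans cB); apply: conjugate_trans (conjugate_sym cD).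
have Bu : B \in unitmx by rewrite unitmxE detB -unitmxE.
have Du : D \in unitmx by rewrite unitmxE detD -unitmxE.
apply: conjugate_shear => //; apply: (@det_matrix_path _ _ iota) => //.
by rewrite det_mulmx det_inv detB detD.
Qed.

End Shear.

(** * Similarity of nilpotent matrices *)

Section NilpotentSimilarity.
Variable F : fieldType.

(** The rows of M are completed to a basis Z. *)
Lemma row_free_complete k s (M : 'M[F]_(k, k + s)) : row_free M ->
  exists2 Z : 'M[F]_(k + s), Z \in unitmx & M = row_mx 1%:M 0 *m Z.
Proof.
move=> /eqP rM; exists (block_mx (col_ebase M) 0 0 1%:M *m row_ebase M).
  rewrite unitmx_mul row_ebase_unit andbT unitmxE det_ublock det1 mulr1.
  by rewrite -unitmxE col_ebase_unit.
rewrite mulmxA mul_row_block !mul0mx !mulmx0 !mul1mx !addr0.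
rewrite -{1}(mulmx_ebase M) rM -[pid_mx k]/(pid_mx k : 'M[F]_(k, k + s)) pid_mx_row.
by rewrite mul_mx_row mulmx1 mulmx0.
Qed.

Lemma row_free_transport k n (M M' : 'M[F]_(k, n)) : row_free M -> row_free M' ->
  exists2 Z : 'M[F]_n, Z \in unitmx & M = M' *m Z.
Proof.
move=> fM fM'; have kn : (k <= n)%N by rewrite -(eqP fM) rank_leq_col.
move: M M' fM fM'; rewrite -(subnKC kn) => M M'.
move=> /row_free_complete[Z Zu ->] /row_free_complete[Z' Zu' ->].
exists (invmx Z' *m Z); first by rewrite unitmx_mul unitmx_inv Zu'.
by rewrite -mulmxA mulKVmx.
Qed.

(** A space of column vectors is the annihilator of its annihilator. *)
Lemma left_kernel_image r s (N : 'M[F]_r) (v : 'M[F]_(r, s)) :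
  kermx N *m v = 0 -> exists Y, v = N *m Y.
Proof.
move=> Kv; have sub : (N^T <= kermx (kermx N)^T)%MS.
  by apply/sub_kermxP; rewrite -trmx_mul mulmx_ker trmx0.
have eqK : (kermx (kermx N)^T <= N^T)%MS.
  have [_ <-] := mxrank_leqif_sup sub.
  by rewrite mxrank_ker !mxrank_tr mxrank_ker subKn// rank_leq_row.
have : (v^T <= N^T)%MS.
  apply: submx_trans eqK; apply/sub_kermxP.
  by rewrite -trmx_mul Kv trmx0.
by move=> /submxP[Y vY]; exists Y^T; rewrite -[v]trmxK vY trmx_mul trmxK.
Qed.

(** Let K span the left kernel of N. The maps K M and K M' are surjective
    by the rank hypotheses, so an invertible Z carries one to the other; then
    M - M' Z is killed by K, hence lies in the image of N. *)
Lemma row_mx_transport r s (N : 'M[F]_r) (M M' : 'M[F]_(r, s)) :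
    row_free (row_mx N M) -> row_free (row_mx N M') ->
  exists Y Z, Z \in unitmx /\ N *m Y + M' *m Z = M.
Proof.
pose K := row_base (kermx N).
have eqK : (K :=: kermx N)%MS by exact: eq_row_base.
have freeK : row_free K by exact: row_base_free.
have KN : K *m N = 0 by apply/eqP; rewrite -sub_kermx eqK.
clearbody K.
have fK (P : 'M[F]_(r, s)) : row_free (row_mx N P) -> row_free (K *m P).
  move=> fP; apply/inj_row_free => u uKP.
  have : u *m K *m row_mx N P = 0.
    by rewrite mul_mx_row -!mulmxA KN uKP mulmx0 row_mx0.
  move=> /(congr1 (mulmxr (pinvmx (row_mx N P)))) /=; rewrite mul0mx mulmxKp//.
  move=> /(congr1 (mulmxr (pinvmx K))) /=; by rewrite mul0mx mulmxKp.
move=> fM fM'; have [Z Zu KMZ] := row_free_transport (fK _ fM) (fK _ fM').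
have [Y MY] : exists Y, M - M' *m Z = N *m Y.
  apply: left_kernel_image.
  have /submxP[D ->] : (kermx N <= K)%MS by rewrite eqK submx_refl.
  by rewrite -mulmxA mulmxBr [K *m (M' *m Z)]mulmxA -KMZ subrr mulmx0.
by exists Y, Z; split=> //; rewrite -MY subrK.
Qed.

Lemma mxrank_mul_inj m r s (X : 'M[F]_(m, r)) (B : 'M[F]_(r, s)) :
  \rank X = r -> \rank (X *m B) = \rank B.
Proof.
move=> rX; rewrite -(mxrank_tr (X *m B)) trmx_mul mxrankMfree ?mxrank_tr//.
by rewrite /row_free mxrank_tr rX.
Qed.

(** In coordinates where both P and P' are the inclusion of the first r
    coordinates, Q = (N | M) and Q' = (N | M') share the block N = Q P, and T may be
    sought block triangular with first column that of 1. *)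
Lemma factorization_similar q r (P P' : 'M[F]_(q, r)) (Q Q' : 'M[F]_(r, q)) :
    \rank P = r -> \rank P' = r -> \rank Q = r -> \rank Q' = r ->
    Q *m P = Q' *m P' ->
  exists2 T : 'M[F]_q, T \in unitmx & T *m P = P' /\ Q' *m T = Q.
Proof.
move=> rP rP' rQ rQ'; have rq : (r <= q)%N by rewrite -rQ rank_leq_col.
move: P P' Q Q' rP rP' rQ rQ'; rewrite -(subnKC rq).
move: (q - r)%N => s P P' Q Q' rP rP' rQ rQ' QP.
have left_form (A : 'M[F]_(r + s, r)) : \rank A = r ->
    exists2 X : 'M[F]_(r + s), X \in unitmx & A = X *m col_mx 1%:M 0.
  move=> rA; have [|X Xu AX] := @row_free_complete r s A^T.
    by rewrite /row_free mxrank_tr rA.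
  exists X^T; first by rewrite unitmx_tr.
  by rewrite -[A]trmxK AX trmx_mul tr_row_mx trmx1 trmx0.
have [X Xu PX] := left_form P rP; have [X' Xu' PX'] := left_form P' rP'.
pose N := lsubmx (Q *m X); pose M := rsubmx (Q *m X).
pose M' := rsubmx (Q' *m X').
have QX : Q *m X = row_mx N M by rewrite hsubmxK.
have lsubE (B : 'M[F]_(r, r + s)) : lsubmx B = B *m col_mx 1%:M 0.
  by rewrite -{2}[B]hsubmxK mul_row_col mulmx1 mulmx0 addr0.
have QX' : Q' *m X' = row_mx N M'.
  by rewrite -[LHS]hsubmxK; congr row_mx; rewrite /N !lsubE -!mulmxA -PX -PX'.
have free (A B : 'M[F]_(r, _)) (Y : 'M[F]_(r + s)) : Y \in unitmx -> \rank A = r ->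
    A *m Y = B -> row_free B.
  by move=> Yu rA <-; rewrite /row_free mxrankMfree ?rA// row_free_unit.
have [Y [Z [Zu YZ]]] := row_mx_transport (free _ _ _ Xu rQ QX) (free _ _ _ Xu' rQ' QX').
pose T := block_mx 1%:M Y 0 Z.
have Tu : T \in unitmx by rewrite unitmxE det_ublock det1 mul1r -unitmxE.
exists (X' *m T *m invmx X); first by rewrite !unitmx_mul Xu' Tu unitmx_inv.
split.
  rewrite {1}PX -!mulmxA mulKmx// PX' mul_block_col !mulmx0 mulmx1 mul0mx.
  by rewrite !addr0.
rewrite !mulmxA QX' mul_row_block mulmx0 mulmx1 addr0 YZ -QX.
by rewrite mulmxK.
Qed.

Lemma nilpotent_mx_unit n (A : 'M[F]_n) : nilpotent_mx A -> A \in unitmx -> n = 0%N.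
Proof.
move=> [k Ak] Au.
have : A ^+ k \in unitmx.
  by elim: k {Ak} => [|k IH]; rewrite ?unitmx1// exprS unitmx_mul Au.
rewrite Ak => /mxrank_unit; rewrite mxrank0 => /esym; exact.
Qed.

Lemma nilpotent_mxP n (A : 'M[F]_n) : nilpotent_mx A <-> exists k, \rank (A ^+ k) = 0%N.
Proof.
split=> -[k Ak]; exists k; first by rewrite Ak mxrank0.
by apply/eqP; rewrite -mxrank_eq0 Ak.
Qed.

(** By induction on the size. Factor A = P Q through its image; the induced
    operator on the image is Q P, and its powers have the ranks of the next
    powers of A. The induction hypothesis makes Q P and Q' P' equal after a change
    of basis of the image, and [factorization_similar] lifts this to A and C. *)
Lemma nilpotent_similar n (A C : 'M[F]_n) : nilpotent_mx A ->
    (forall k, \rank (A ^+ k) = \rank (C ^+ k)) ->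
  exists2 T, T \in unitmx & T *m A = C *m T.
Proof.
have [b] := ubnP n; elim: b n A C => // b IH n A C nb nilA rAC.
have [n0|n_gt0] := posnP n.
  exists 1%:M; first exact: unitmx1.
  by apply/matrixP => i; have := ltn_ord i; rewrite {2}n0.
have rA : (\rank A < n)%N.
  rewrite ltn_neqAle rank_leq_row andbT; apply/negP => /eqP rA.
  have : A \in unitmx by rewrite -row_free_unit /row_free rA.
  by move=> /(nilpotent_mx_unit nilA) n0; rewrite n0 in n_gt0.
have factor (B : 'M[F]_n) r : \rank B = r ->
    exists (P : 'M[F]_(n, r)) (Q : 'M[F]_(r, n)),
      [/\ B = P *m Q, \rank P = r & \rank Q = r].
  move=> <-; exists (col_base B), (row_base B).
  by rewrite mulmx_base eq_row_base -mxrank_tr; split=> //; apply/eqP;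
    rewrite ?mxrank_tr; exact: col_base_full.
have rC : \rank C = \rank A by have := rAC 1%N; rewrite !expr1.
have [P [Q [APQ rP rQ]]] := factor A _ erefl.
have [P' [Q' [CPQ rP' rQ']]] := factor C _ rC.
have rank_pow (B : 'M[F]_n) (X : 'M[F]_(n, \rank A)) (Y : 'M[F]_(\rank A, n)) k :
    B = X *m Y -> \rank X = \rank A -> \rank Y = \rank A ->
    \rank ((Y *m X) ^+ k) = \rank (B ^+ k.+1).
  move=> BXY rX rY.
  have -> : B ^+ k.+1 = X *m (Y *m X) ^+ k *m Y.
    elim: k => [|k IHk]; first by rewrite expr1 expr0 mulmx1.
    by rewrite exprS IHk {1}BXY -!mulmxE !mulmxA exprS -mulmxE !mulmxA.
  rewrite mxrankMfree; last by rewrite /row_free rY.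
  by rewrite mxrank_mul_inj.
have [|||S Su SAC] := IH _ (Q *m P) (Q' *m P').
- by apply: leq_trans rA _; rewrite -ltnS.
- apply/nilpotent_mxP; have [k Ak] := nilA; exists k.
  by rewrite (rank_pow A)// exprS Ak mulr0 mxrank0.
- by move=> k; rewrite (rank_pow A)// (rank_pow C)// rAC.
have [|||||T Tu [TP QT]] := @factorization_similar n (\rank A)
  (P *m invmx S) P' (S *m Q) Q'.
- by rewrite mxrankMfree// row_free_unit unitmx_inv.
- by [].
- by rewrite mxrank_mul_inj// mxrank_unit.
- by [].
- by rewrite !mulmxA -(mulmxA S) SAC mulmxK.
exists T => //; rewrite CPQ -mulmxA QT -TP.
by rewrite -!mulmxA mulKmx// -APQ.
Qed.

End NilpotentSimilarity.

(** * Invariance of dimension and orientation *)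

Lemma sub_entryC (K : numFieldType) m n (A B : 'M[K]_(m, n)) i j :
  (B - A) i j = - (A - B) i j.
Proof. by rewrite !mxE opprB. Qed.

Section InvarianceOfDimension.
Variable R : realType.

Lemma borsuk_ulam_ord m n (f : 'I_m -> 'rV[R]_n -> R) : (m < n)%N ->
    (forall i, continuous (f i)) -> (forall i x, f i (- x) = - f i x) ->
  exists2 x, x != 0 & forall i, f i x = 0.
Proof.
case: n f => // N f mN cf fodd; pose g i x := oapp (f^~ x) 0 (insub i : option 'I_m).
have gE i (im : (i < m)%N) : g i = f (Ordinal im).
  by apply/funext => x; rewrite /g insubT.
have [|i x im|x x0 fx] := @borsuk_ulam R N m g mN.
- by move=> i im; rewrite gE.
- by rewrite !gE.
by exists x => // i; rewrite -(fx i (ltn_ord i)) gE; congr f; exact: val_inj.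
Qed.

(** Invariance of dimension, in the form that no vector space over K injects
    continuously into a smaller one. *)
Definition injective_dim (K : numFieldType) := forall a b (h : 'cV[K]_b -> 'cV[K]_a),
  continuous h -> injective h -> (b <= a)%N.

(** Borsuk-Ulam for the odd map x |-> h x - h (- x). *)
Lemma injective_dim_real : injective_dim (R : numFieldType).
Proof.
move=> a [|N] h ch hI //; rewrite leqNgt; apply/negP => aN.
have cid : continuous (@id 'rV[R]_N.+1) by move=> x; exact: cvg_id.
have [|i x|x x0 fx] := @borsuk_ulam_ord a N.+1
    (fun i x => (h x^T - h (- x^T)) i 0) aN.
- move=> i; apply: continuous_entry; apply: continuous_addmx.
    exact: (continuous_compose (continuous_trmx cid) ch).
  apply: continuous_oppmx.
  exact: (continuous_compose (continuous_oppmx (continuous_trmx cid)) ch).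
- by rewrite linearN opprK sub_entryC.
have : h x^T = h (- x^T).
  apply/eqP; rewrite -subr_eq0; apply/eqP/colP => i.
  by rewrite fx mxE.
move=> /hI xN; case/eqP: x0; apply: trmx_inj; rewrite trmx0; apply/colP => i.
have := congr1 (fun z : 'cV_N.+1 => z i 0) xN; rewrite mxE [RHS]mxE [in RHS]mxE => /eqP.
by rewrite -addr_eq0 -mulr2n mulrn_eq0 /= => /eqP ->; rewrite mxE.
Qed.

End InvarianceOfDimension.

Section Complex.
Variable R : realType.

Lemma continuous_Re : continuous (fun z : (R[i] : numFieldType) => complex.Re z : R).
Proof.
move=> x; apply/(@cvgrPdist_lt _ _ _ _ (nbhs_filter x)) => e e_gt0.
have eC : 0 < (e%:C)%C :> (R[i] : numFieldType) by rewrite ltcR.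
have := (@cvgrPdist_lt _ _ _ _ (nbhs_filter x) (@id (R[i] : numFieldType)) x).1
  (@cvg_id _ (nbhs x)) _ eC.
apply: (@filterS _ (nbhs x) (nbhs_filter x)) => z /= xz; rewrite -ltcR; apply: le_lt_trans xz.
by rewrite -raddfB; exact: normc_ge_Re.
Qed.

Lemma continuous_Im : continuous (fun z : (R[i] : numFieldType) => complex.Im z : R).
Proof.
have -> : (fun z : (R[i] : numFieldType) => complex.Im z) =
    (fun z => - complex.Re (z * ('i%C : (R[i] : numFieldType)))).
  by apply/funext => z; rewrite ReiNIm opprK.
apply: continuous_opp; apply: (continuous_compose _ continuous_Re).
apply: (@continuous_mul (R[i] : numFieldType) _ id (fun=> 'i%C)).
  by move=> x; exact: cvg_id.
exact: cst_continuous.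
Qed.

Lemma continuous_real_complex : continuous (fun t : R => (t%:C)%C : (R[i] : numFieldType)).
Proof.
move=> x; apply/(@cvgrPdist_lt _ _ _ _ (nbhs_filter x)) => e; rewrite ltcE => /andP[/eqP Ime Ree].
have := (@cvgrPdist_lt _ _ _ _ (nbhs_filter x) (@id R) x).1 (@cvg_id _ (nbhs x)) _ Ree.
apply: (@filterS _ (nbhs x) (nbhs_filter x)) => z /= xz.
rewrite -raddfB normc_def /= expr0n addr0 sqrtr_sqr.
by rewrite ltcE /= Ime eqxx.
Qed.

Definition complexify n (x : 'rV[R]_(n + n)) : 'cV[R[i] : numFieldType]_n :=
  \col_i ((x 0 (lshift n i))%:C + 'i * (x 0 (rshift n i))%:C)%C.

Lemma continuous_complexify n : continuous (@complexify n).
Proof.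
have ce j : continuous (fun x : 'rV[R]_(n + n) => (x 0 j)%:C%C : (R[i] : numFieldType)).
  apply: (continuous_compose _ continuous_real_complex).
  by apply: continuous_entry => x; exact: cvg_id.
apply: continuous_matrix => i j.
have -> : (fun x : 'rV[R]_(n + n) => complexify x i j) =
    (fun x => ((x 0 (lshift n i))%:C + 'i * (x 0 (rshift n i))%:C)%C).
  by apply/funext => x; rewrite mxE.
apply: continuous_add; first exact: ce.
by apply: continuous_mul; [exact: cst_continuous|exact: ce].
Qed.

Lemma complexify_inj n : injective (@complexify n).
Proof.
move=> x y xy; apply/rowP => j.
have E i := congr1 (fun z : 'cV_n => z i 0) xy.
case: (split_ordP j) => i ->; have /eqP := E i; rewrite !mxE eq_complex /=;
  rewrite !(mul0r, mulr0, mul1r, addr0, add0r, subr0, oppr0);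
  by move=> /andP[/eqP + /eqP +].
Qed.

(** Borsuk-Ulam for the real and imaginary parts of x |-> h x - h (- x), with
    twice as many real coordinates on both sides. *)
Lemma injective_dim_complex : injective_dim (R[i] : numFieldType).
Proof.
move=> a [|N] h ch hI //; rewrite leqNgt; apply/negP => aN.
pose Q (x : 'rV[R]_(N.+1 + N.+1)) : 'cV_a := h (complexify x) - h (complexify (- x)).
have cQ : continuous Q.
  apply: continuous_addmx.
    exact: (continuous_compose (@continuous_complexify _) ch).
  apply: continuous_oppmx.
  have cN : continuous (fun x : 'rV[R]_(N.+1 + N.+1) => - x).
    by apply: continuous_oppmx => x; exact: cvg_id.
  exact: (continuous_compose (continuous_compose cN (@continuous_complexify _)) ch).
have QN x i : Q (- x) i 0 = - Q x i 0 by rewrite /Q opprK sub_entryC.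
pose f (i : 'I_(a + a)) (x : 'rV[R]_(N.+1 + N.+1)) : R :=
  match fintype.split i with
  | inl j => complex.Re (Q x j 0) | inr j => complex.Im (Q x j 0) end.
have [||i x|x x0 fx] := @borsuk_ulam_ord R (a + a) (N.+1 + N.+1) f.
- by apply: (leq_ltn_trans (leq_add (leqnn a) (ltnW aN))); rewrite ltn_add2r.
- move=> i; rewrite /f; case: (fintype.split i) => j.
    exact: (continuous_compose (@continuous_entry _ _ _ _ Q j 0 cQ) continuous_Re).
  exact: (continuous_compose (@continuous_entry _ _ _ _ Q j 0 cQ) continuous_Im).
- by rewrite /f; case: (fintype.split i) => j; rewrite QN; case: (Q x j 0).
have Q0 : Q x = 0.
  apply/colP => j; apply/eqP; rewrite [eqbRHS]mxE eq_complex.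
  have := fx (lshift a j); have := fx (rshift a j); rewrite /f.
  have -> : fintype.split (lshift a j) = inl j := unsplitK (inl j).
  have -> : fintype.split (rshift a j) = inr j := unsplitK (inr j).
  move=> -> ->.
  by rewrite !eqxx.
move/eqP: Q0; rewrite subr_eq0 => /eqP/hI/complexify_inj => xN.
case/eqP: x0; apply/rowP => i.
have := congr1 (fun z : 'rV_(N.+1 + N.+1) => z 0 i) xN; rewrite [RHS]mxE => /eqP.
by rewrite -addr_eq0 -mulr2n mulrn_eq0 /= => /eqP ->; rewrite mxE.
Qed.

Lemma continuous_complex (T : topologicalType) (f g : T -> R) :
  continuous f -> continuous g ->
  continuous (fun x => (f x +i* g x)%C : (R[i] : numFieldType)).
Proof.
move=> cf cg.
have -> : (fun x => (f x +i* g x)%C : (R[i] : numFieldType)) =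
    (fun x => ((f x)%:C + 'i * (g x)%:C)%C).
  by apply/funext => x; rewrite [LHS]complexE.
apply: continuous_add; first exact: (continuous_compose cf continuous_real_complex).
apply: continuous_mul; first exact: cst_continuous.
exact: (continuous_compose cg continuous_real_complex).
Qed.

(** The segment from 1 to d is bent into the closed half plane that contains d, off
    the real axis; the parameter u stays in [0, 1] for all times. *)
Lemma scalar_path_complex (d : (R[i] : numFieldType)) : d != 0 -> scalar_path R d.
Proof.
move=> d0; pose u (t : R) := (1 - cos (pi * t)) / 2.
have u01 t : 0 <= u t <= 1.
  by rewrite /u; have := cos_le1 (pi * t); have := cos_geN1 (pi * t); nra.
have u0 : u 0 = 0 by rewrite /u mulr0 cos0 subrr mul0r.
have u1 : u 1 = 1 by rewrite /u mulr1 cospi opprK divff// pnatr_eq0.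
have cu : continuous u.
  move=> t; apply: cvgMl; apply: cvgB; first exact: cvg_cst.
  apply: (continuous_comp (g := cos)); last exact: continuous_cos.
  by apply: cvgMr; exact: cvg_id.
pose e : R := if 0 <= complex.Im d then 1 else - 1.
exists (fun t => ((1 + u t * (complex.Re d - 1)) +i*
  (u t * (complex.Im d + e * (1 - u t))))%C); split.
- have ck (k : R) : continuous (fun _ : R => k) by exact: cst_continuous.
  apply: continuous_complex.
    by apply: continuous_add => //; apply: continuous_mul.
  apply: continuous_mul => //; apply: continuous_add => //; apply: continuous_mul => //.
  by apply: continuous_add => //; exact: continuous_opp.
- move=> t; rewrite eq_complex /=; apply/negP => /andP[/eqP Re0].
  have /andP[ut0 ut1] := u01 t.
  rewrite mulf_eq0 => /orP[/eqP ut|/eqP Im0].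
    by move: Re0; rewrite ut mul0r addr0 => /eqP; rewrite oner_eq0.
  have [Imd ut] : complex.Im d = 0 /\ u t = 1.
    by move: Im0; rewrite /e; case: ifP => [|/negbT]; rewrite -?ltNge => *; split; nra.
  move: Re0; rewrite ut mul1r addrC subrK => Red.
  by move: d0; rewrite eq_complex Red Imd eqxx.
- by rewrite u0 !mul0r addr0.
- by rewrite u1 !mul1r subrr mulr0 addr0 addrC subrK; case: (d).
Qed.

End Complex.

Lemma scalar_path_real (R : realType) (d : (R : numFieldType)) :
  0 < d -> scalar_path R d.
Proof.
move=> d0; exists (fun t => expR (ln d * t)); split.
- move=> t; apply: (continuous_comp (g := expR)); last exact: continuous_expR.
  by apply: cvgMr; exact: cvg_id.
- by move=> t; rewrite gt_eqF// expR_gt0.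
- by rewrite mulr0 expR0.
- by rewrite mulr1 lnK// posrE.
Qed.

Section Orientation.
Variables (R : realType) (N : nat).
Let n := N.+2.

Definition reflection_mx : 'M[R]_n := diag_mx (\row_j (if j == ord_max then -1 else 1)).

Lemma reflection_mx_last (v : 'rV[R]_n) : (reflect_last v)^T = reflection_mx *m v^T.
Proof.
apply/colP => i; rewrite mul_diag_mx !mxE.
by case: ifP => _; rewrite ?mulN1r ?mul1r.
Qed.

Definition first_vector : 'cV[R]_n := delta_mx 0 0.

Lemma reflection_mx_first_vector : reflection_mx *m first_vector = first_vector.
Proof.
apply/colP => i; rewrite mul_diag_mx !mxE.
by have [->|_] := eqVneq i 0; rewrite ?mul1r ?mulr0.
Qed.

(** A conjugacy h would satisfy h (E x + e) = h x + e, and the differences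
    h (s e + v) - h (s e - v) would form a family excluded by
    [no_reflected_odd_family]. *)
Lemma not_conjugate_reflection :
  ~ conjugate (affine 1%:M first_vector) (affine reflection_mx first_vector).
Proof.
move=> /conjugateP[h [k [ch _ hk _ hE]]].
have hI : injective h by exact: can_inj hk.
have hstep x : h (reflection_mx *m x + first_vector) = h x + first_vector.
  by rewrite -/(affine _ _ _) hE /affine mul1mx.
pose V := ('rV[R]_n * R)%type.
pose P (x : V) : 'cV[R]_n := x.2 *: first_vector + x.1^T.
pose M (x : V) : 'cV[R]_n := x.2 *: first_vector - x.1^T.
have cfst : continuous (fun x : V => x.1^T).
  by apply: continuous_trmx => x; exact: cvg_fst.
have csnd : continuous (fun x : V => x.2 *: first_vector).
  by apply: continuous_scalemx; [move=> x; exact: cvg_snd|exact: continuous_cstmx].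
have cP : continuous P := continuous_addmx csnd cfst.
have cM : continuous M := continuous_addmx csnd (continuous_oppmx cfst).
pose F (x : V) := h (P x) - h (M x).
have cF : continuous F.
  apply: continuous_addmx; first exact: (continuous_compose cP ch).
  by apply: continuous_oppmx; exact: (continuous_compose cM ch).
pose f (i : nat) (x : V) : R := F x (inord i) 0.
apply: (@no_reflected_odd_family R N.+1 f).
- by move=> i _; exact: continuous_entry.
- move=> i x _; rewrite /f /F /P /M /= linearN opprK.
  exact: sub_entryC.
- move=> x x0; apply: contrapT => fx; case/eqP: x0.
  have PM : P x = M x.
    apply: hI; apply/eqP; rewrite -subr_eq0; apply/eqP/colP => i.
    rewrite [RHS]mxE; apply/eqP/negPn/negP => Fi; apply: fx; exists i => //.
    by rewrite /f inord_val.
  move/addrI: PM => xN; apply: trmx_inj; rewrite trmx0; apply/colP => i.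
  have := congr1 (fun z : 'cV_n => z i 0) xN; rewrite mxE [RHS]mxE [in RHS]mxE.
  by move=> /eqP; rewrite -addr_eq0 -mulr2n mulrn_eq0 /= => /eqP ->; rewrite mxE.
- move=> i x _; rewrite /f /F; congr (fun_of_matrix _ _ _).
  have -> : P (reflect_last x.1, x.2 + 1) = reflection_mx *m P x + first_vector.
    rewrite /P /= reflection_mx_last mulmxDr -scalemxAr reflection_mx_first_vector.
    by rewrite scalerDl scale1r addrAC.
  have -> : M (reflect_last x.1, x.2 + 1) = reflection_mx *m M x + first_vector.
    rewrite /M /= reflection_mx_last mulmxBr -scalemxAr reflection_mx_first_vector.
    by rewrite scalerDl scale1r addrAC.
  by rewrite !hstep opprD addrACA subrr addr0.
Qed.

End Orientation.

(** * Splitting affine maps *)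

Lemma similar_mxP (K : fieldType) n (M N : 'M[K]_n) :
  similar_mx M N <-> exists2 S, S \in unitmx & S *m M = N *m S.
Proof.
split=> [[e [S [Su <-]]]|[S Su SM]].
  exists (invmx S); first by rewrite unitmx_inv.
  by rewrite (eq_irrelevance e erefl) castmx_id mulmxK.
exists erefl, (invmx S); split; first by rewrite unitmx_inv.
by rewrite castmx_id invmxK SM mulmxK.
Qed.

Lemma similar_mx_pow_rank (K : fieldType) n (M N : 'M[K]_n) k :
  similar_mx M N -> \rank (M ^+ k) = \rank (N ^+ k).
Proof.
move=> /similar_mxP[S Su SM].
have SMk : S *m M ^+ k = N ^+ k *m S.
  elim: k => [|k IH]; first by rewrite !expr0 mulmx1 mul1mx.
  by rewrite exprSr -mulmxE mulmxA IH -mulmxA SM mulmxA exprSr -mulmxE.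
by rewrite -(mxrank_mul_inj _ (mxrank_unit Su)) SMk mxrankMfree// row_free_unit.
Qed.

Lemma block_diag_pow (K : fieldType) p q (A : 'M[K]_p) (C : 'M[K]_q) k :
  (block_mx A 0 0 C) ^+ k = block_mx (A ^+ k) 0 0 (C ^+ k).
Proof.
elim: k => [|k IH]; first by rewrite !expr0 -scalar_mx_block.
by rewrite !exprS IH -mulmxE mulmx_block !mulmx0 !mul0mx !addr0 !add0r.
Qed.

Lemma parts_pow_rank (K : fieldType) n p q (A : 'M[K]_n) (As : 'M[K]_p) (A0 : 'M[K]_q) k :
  nonsingular_nilpotent_parts A As A0 ->
  \rank (A ^+ k) = (p + \rank (A0 ^+ k))%N.
Proof.
move=> [Asu nil0 simA]; have [e _] := simA; subst n.
rewrite (similar_mx_pow_rank _ simA) block_diag_pow rank_diag_block_mx.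
congr (_ + _)%N; apply: mxrank_unit; elim: k => [|k IH]; first exact: unitmx1.
by rewrite exprS unitmx_mul Asu.
Qed.

Section AffineIterates.
Variable K : numFieldType.

Lemma iter_affine n (A : 'M[K]_n) b k :
  exists c, forall x, iter k (affine A b) x = affine (A ^+ k) c x.
Proof.
elim: k => [|k [c IH]]; first by exists 0 => x; rewrite /affine mul1mx addr0.
exists (A *m c + b) => x; rewrite iterS IH /affine mulmxDr mulmxA addrA.
by rewrite exprS.
Qed.

(** A power of the map is constant, and its value is fixed. *)
Lemma nilpotent_fixed_point n (A : 'M[K]_n) b : nilpotent_mx A ->
  has_fixed_point (affine A b).
Proof.
move=> [k Ak]; have [c itc] := iter_affine A b k.
have itE x : iter k (affine A b) x = c by rewrite itc /affine Ak mul0mx add0r.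
by exists c; rewrite -{1}(itE 0) -iterS iterSr itE.
Qed.

(** The image of x |-> C x + d, a copy of K^(rank C), is carried by h injectively
    into the image of x |-> A x + b, a copy of K^(rank A). *)
Lemma affine_image_rank n (A C : 'M[K]_n) b d (h : 'cV[K]_n -> 'cV[K]_n) :
    injective_dim K -> continuous h -> injective h ->
    (forall x, h (affine C d x) = affine A b (h x)) ->
  (\rank C <= \rank A)%N.
Proof.
move=> dimK ch hI hE.
pose u (y : 'cV[K]_(\rank C)) := d + col_base C *m y.
pose L : 'M[K]_(\rank A, n) := (pinvmx (col_base A)^T)^T.
have LA : L *m col_base A = 1%:M.
  by rewrite -[L *m _]trmxK trmx_mul trmxK mulmxVp ?trmx1// /row_free mxrank_tr
    (eqP (col_base_full _)).
pose P := pinvmx (row_base C).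
have CP : C *m P = col_base C.
  have := congr1 (mulmxr P) (mulmx_base C).
  by rewrite /= -mulmxA mulmxVp ?row_base_free// mulmx1 => <-.
have uE y : u y = affine C d (P *m y).
  by rewrite /u /affine mulmxA CP addrC.
apply: (dimK _ _ (fun y => L *m (h (u y) - b))).
  have cid : continuous (@id 'cV[K]_(\rank C)) by move=> x; exact: cvg_id.
  have cu : continuous u.
    apply: continuous_addmx; first exact: continuous_cstmx.
    by apply: continuous_mulmx; [exact: continuous_cstmx|exact: cid].
  apply: continuous_mulmx; first exact: continuous_cstmx.
  apply: continuous_addmx; last exact: continuous_cstmx.
  exact: (continuous_compose cu ch).
move=> y z; rewrite !uE !hE /affine !addrK => Lyz.
have : affine C d (P *m y) = affine C d (P *m z).
  apply: hI; rewrite !hE /affine; congr (_ + b).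
  have AE (w : 'cV[K]_n) : A *m w = col_base A *m (row_base A *m w).
    by rewrite mulmxA mulmx_base.
  by move: Lyz; rewrite !AE !(mulmxA L (col_base A)) LA !mul1mx => ->.
rewrite -!uE => /addrI E.
have fC : row_free (col_base C)^T by rewrite /row_free mxrank_tr (eqP (col_base_full _)).
apply: trmx_inj; rewrite -[LHS]mulmx1 -[RHS]mulmx1 -(mulmxVp fC) !mulmxA.
by rewrite -!trmx_mul E.
Qed.

Lemma conjugate_pow_rank n (A C : 'M[K]_n) b d k : injective_dim K ->
  conjugate (affine A b) (affine C d) -> \rank (A ^+ k) = \rank (C ^+ k).
Proof.
move=> dimK.
suff le (A' C' : 'M[K]_n) b' d' : conjugate (affine A' b') (affine C' d') ->
    (\rank (C' ^+ k) <= \rank (A' ^+ k))%N.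
  by move=> fg; apply/eqP; rewrite eqn_leq (le _ _ _ _ (conjugate_sym fg)) (le _ _ _ _ fg).
move=> /conjugateP[h [l [ch _ hl _ hE]]].
have [a ha] := iter_affine A' b' k; have [c hc] := iter_affine C' d' k.
apply: (@affine_image_rank _ _ _ a c h) => //; first exact: can_inj hl.
move=> x; rewrite -ha -hc; elim: k {ha hc} x => //= k IH x.
by rewrite hE IH.
Qed.

Lemma affine_iter_surjective n (A : 'M[K]_n) b k x : A \in unitmx ->
  exists y, iter k (affine A b) y = x.
Proof.
move=> Au; elim: k x => [|k IH] x; first by exists x.
have [y yx] := IH (invmx A *m (x - b)); exists y.
by rewrite iterS yx /affine mulKVmx// subrK.
Qed.

(** The slice {second component = 0} is the image of a high power of either
    product map, so a conjugacy preserves it. *)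
Lemma conjugate_core (T U : topologicalType) q s (A0 : 'M[K]_q) (C0 : 'M[K]_s)
    (f : T -> T) (g : U -> U) :
    nilpotent_mx A0 -> nilpotent_mx C0 ->
    (forall k x, exists y, iter k f y = x) -> (forall k x, exists y, iter k g y = x) ->
    conjugate (fun x : T * 'cV[K]_q => (f x.1, A0 *m x.2))
              (fun x : U * 'cV[K]_s => (g x.1, C0 *m x.2)) ->
  conjugate f g.
Proof.
have core (T' U' : topologicalType) q' s' (A0' : 'M[K]_q') (C0' : 'M[K]_s')
    (f' : T' -> T') (g' : U' -> U') (h : U' * 'cV[K]_s' -> T' * 'cV[K]_q') :
    nilpotent_mx A0' -> (forall k x, exists y, iter k g' y = x) ->
    (forall x, h (g' x.1, C0' *m x.2) = (f' (h x).1, A0' *m (h x).2)) ->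
    forall x, (h (x, 0)).2 = 0.
  move=> [k Ak] surj hE x; have [y <-] := surj k x.
  have it j : h (iter j g' y, 0) =
      (iter j f' (h (y, 0)).1, A0' ^+ j *m (h (y, 0)).2).
    elim: j => [|j IH]; first by rewrite mul1mx; case: (h _).
    have := hE (iter j g' y, 0); rewrite IH /= mulmx0 => ->.
    by rewrite mulmxA exprS.
  by rewrite it Ak mul0mx.
move=> nilA nilC surjf surjg /conjugateP[h [k [ch ck hk kh hE]]].
have kE x : k (f x.1, A0 *m x.2) = (g (k x).1, C0 *m (k x).2).
  by apply: (can_inj hk); rewrite kh hE kh.
have h2 := core _ _ _ _ _ _ _ _ _ nilA surjg hE.
have k2 := core _ _ _ _ _ _ _ _ _ nilC surjf kE.
apply/conjugateP; exists (fun x => (h (x, 0)).1), (fun x => (k (x, 0)).1).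
have cfst (X : topologicalType) m : continuous (fun x : X * 'cV[K]_m => x.1).
  by move=> x; exact: cvg_fst.
have cin (X : topologicalType) m : continuous (fun x : X => (x, 0 : 'cV[K]_m)).
  by apply: continuous_pair; [move=> x; exact: cvg_id|exact: continuous_cstmx].
split.
- exact: (continuous_compose (continuous_compose (cin _ _) ch) (cfst _ _)).
- exact: (continuous_compose (continuous_compose (cin _ _) ck) (cfst _ _)).
- move=> x; have -> : ((h (x, 0)).1, 0) = h (x, 0) by rewrite -(h2 x); case: (h _).
  by rewrite hk.
- move=> x; have -> : ((k (x, 0)).1, 0) = k (x, 0) by rewrite -(k2 x); case: (k _).
  by rewrite kh.
- by move=> x; have := hE (x, 0); rewrite /= mulmx0 => ->.
Qed.

Lemma conjugate_parts n p q (A : 'M[K]_n) b (As : 'M[K]_p) (A0 : 'M[K]_q) :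
    nonsingular_nilpotent_parts A As A0 -> ~ has_fixed_point (affine A b) ->
  exists2 b1, ~ has_fixed_point (affine As b1) &
    conjugate (affine A b) (fun x : 'cV[K]_p * 'cV[K]_q => (affine As b1 x.1, A0 *m x.2)).
Proof.
move=> [Asu nil0 simA] nofix; have [e _] := simA; subst n.
have [S Su SA] := (similar_mxP _ _).1 simA.
pose b1 := usubmx (S *m b); pose b0 := dsubmx (S *m b).
have [x0 fx0] := nilpotent_fixed_point b0 nil0.
have conjA : conjugate (affine A b)
    (fun x : 'cV[K]_p * 'cV[K]_q => (affine As b1 x.1, A0 *m x.2)).
  apply: conjugate_trans (conjugate_similar Su SA (esym (vsubmxK _))) _.
  apply: conjugate_trans (conjugate_split _ _ _ _) _.
  by apply: conjugate_prod; [exact: conjugate_refl|exact: conjugate_translation fx0].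
exists b1 => //; move=> [x1 fx1]; apply: nofix.
apply: (fixed_point_conjugate (conjugate_sym conjA)).
by exists (x1, 0); rewrite /= fx1 mulmx0.
Qed.

End AffineIterates.

Section NoFixedPoints.
Variables (R : realType) (K : numFieldType) (iota : R -> K) (re : K -> R).
Hypotheses (iota_cont : continuous iota) (iota0 : iota 0 = 0) (iota1 : iota 1 = 1).
Hypotheses (re_cont : continuous re) (reD1 : forall x, re (x + 1) = re x + 1).
Hypothesis dimK : injective_dim K.
Variables (n p q r s : nat) (A C : 'M[K]_n) (b d : 'cV[K]_n).
Variables (As : 'M[K]_p) (A0 : 'M[K]_q) (Cs : 'M[K]_r) (C0 : 'M[K]_s).
Hypotheses (hA : nonsingular_nilpotent_parts A As A0)
           (hC : nonsingular_nilpotent_parts C Cs C0).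
Hypotheses (nofixA : ~ has_fixed_point (affine A b))
           (nofixC : ~ has_fixed_point (affine C d)).

Lemma conjugate_parts_rank k : conjugate (affine A b) (affine C d) ->
  (p + \rank (A0 ^+ k) = r + \rank (C0 ^+ k))%N.
Proof.
move=> fg; rewrite -(parts_pow_rank _ hA) -(parts_pow_rank _ hC).
exact: conjugate_pow_rank fg.
Qed.

Lemma conjugate_parts_size : conjugate (affine A b) (affine C d) -> p = r.
Proof.
move=> fg; have [_ [k Ak] _] := hA; have [_ [l Cl] _] := hC.
have := conjugate_parts_rank (k + l)%N fg.
by rewrite !exprD Ak Cl mul0r mulr0 !mxrank0 !addn0.
Qed.

Lemma conjugate_nilpotent_similar :
  conjugate (affine A b) (affine C d) -> similar_mx A0 C0.
Proof.
move=> fg; have [_ nilA [eA _]] := hA; have [_ _ [eC _]] := hC.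
have pr := conjugate_parts_size fg; have rk k := conjugate_parts_rank k fg.
have qs : q = s by apply: (@addnI p); rewrite -eA eC pr.
clear hA hC eA eC; subst r s.
have [|T Tu TA] := @nilpotent_similar _ _ A0 C0 nilA.
  by move=> j; apply: (@addnI p); exact: rk.
by apply/similar_mxP; exists T.
Qed.

Lemma conjugate_nonsingular_parts : conjugate (affine A b) (affine C d) ->
  exists b1 d1, [/\ ~ has_fixed_point (affine As b1),
    ~ has_fixed_point (affine Cs d1) & conjugate (affine As b1) (affine Cs d1)].
Proof.
move=> fg; have [b1 nofix1 conjA] := conjugate_parts hA nofixA.
have [d1 nofix1' conjC] := conjugate_parts hC nofixC.
exists b1, d1; split=> //.
have [Asu nilA _] := hA; have [Csu nilC _] := hC.
apply: (conjugate_core nilA nilC).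
- by move=> k x; exact: affine_iter_surjective.
- by move=> k x; exact: affine_iter_surjective.
exact: conjugate_trans (conjugate_sym conjA) (conjugate_trans fg conjC).
Qed.

Lemma similar_nilpotent_conjugate : scalar_path R (\det As / \det Cs) ->
  similar_mx A0 C0 -> conjugate (affine A b) (affine C d).
Proof.
move=> pdet simAC; have [b1 nofix1 conjA] := conjugate_parts hA nofixA.
have [d1 nofix1' conjC] := conjugate_parts hC nofixC.
have [Asu _ [eA _]] := hA; have [Csu _ [eC _]] := hC; have [qs _] := simAC.
have pr : p = r by apply: (@addIn q); rewrite -eA eC qs.
clear hA hC nofixA nofixC; subst s r.
apply: (conjugate_trans conjA); apply: conjugate_trans (conjugate_sym conjC).
apply: conjugate_prod.
  exact: (conjugate_no_fixed_point iota_cont iota0 iota1 re_cont reD1).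
have [S Su SA] := (similar_mxP _ _).1 simAC.
have linE m (M : 'M[K]_m) : (fun x : 'cV[K]_m => M *m x) = affine M 0.
  by apply/funext => x; rewrite /affine addr0.
by have := conjugate_similar Su SA (mulmx0 _ S); rewrite -!linE.
Qed.

End NoFixedPoints.

(** Otherwise, by [conjugate_no_fixed_point], the maps are conjugate to a
    translation and to a translation followed by a reflection. In size 1 a negative
    determinant forces a fixed point, so that there is room for a reflection fixing
    the translation vector. *)
Lemma nonsingular_conjugate_same_sign (R : realType) n (A C : 'M[R]_n) b d :
    A \in unitmx -> C \in unitmx ->
    ~ has_fixed_point (affine A b) -> ~ has_fixed_point (affine C d) ->
    conjugate (affine A b) (affine C d) ->
  0 < \det A * \det C.
Proof.
move=> Au Cu fixA fixC fg.
suff no (M P : 'M[R]_n) (u v : 'cV[R]_n) : ~ has_fixed_point (affine M u) ->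
    ~ has_fixed_point (affine P v) -> conjugate (affine M u) (affine P v) ->
    0 < \det M -> \det P < 0 -> False.
  have := Au; have := Cu; rewrite !unitmxE !unitfE.
  rewrite neq_lt => /orP[C0|C0]; rewrite neq_lt => /orP[A0|A0].
  - by rewrite nmulr_rgt0.
  - by case: (no _ _ _ _ fixA fixC fg A0 C0).
  - by case: (no _ _ _ _ fixC fixA (conjugate_sym fg) C0 A0).
  - by rewrite mulr_gt0.
case: n M P u v {A C b d Au Cu fixA fixC fg} => [|[|N]] M P u v fixM fixP MP M0 P0.
- by move: P0; rewrite det_mx00 ltr10.
(* A matrix of size 1 with a negative entry differs from 1, so the fixed
   point equation has a solution. *)
- apply: fixP; exists ((1 - P 0 0)^-1 *: v).
  have P1 : 1 - P 0 0 != 0.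
    rewrite det_mx11 in P0; rewrite subr_eq0; apply/eqP => P1.
    by move: P0; rewrite -P1 ltr10.
  rewrite /affine [P in P *m _]mx11_scalar mul_scalar_mx scalerA.
  rewrite -{2}[v]scale1r -scalerDl; congr (_ *: _).
  by field.
- have Mu : M \in unitmx by rewrite unitmxE unitfE gt_eqF.
  have Pu : P \in unitmx by rewrite unitmxE unitfE lt_eqF.
  have detE : \det (reflection_mx R N) = -1.
    rewrite det_diag (bigD1 ord_max)//= mxE eqxx big1 ?mulr1// => i im.
    by rewrite mxE (negbTE im).
  have nofix0 (Q : 'M[R]_N.+2) : row 0 Q = row 0 1%:M ->
      ~ has_fixed_point (affine Q (first_vector R N)).
    move=> Q0 [x] /(congr1 (row 0)); rewrite /affine linearD /= row_mul Q0.
    rewrite -row_mul mul1mx => /(congr1 (fun z : 'rV_1 => z 0 0)).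
    rewrite mxE => /(canRL (addKr _)); rewrite addNr !mxE => /eqP.
    by rewrite oner_eq0.
  have real_conj := @conjugate_no_fixed_point R R id id.
  apply: (@not_conjugate_reflection R N).
  have id_cont : continuous (@id R) by move=> x; exact: cvg_id.
  have c1 : conjugate (affine 1%:M (first_vector R N)) (affine M u).
    apply: (real_conj) => //; first exact: unitmx1.
      exact: nofix0.
    by rewrite det1; apply: scalar_path_real; rewrite divr_gt0.
  have c2 : conjugate (affine P v) (affine (reflection_mx R N) (first_vector R N)).
    apply: (real_conj) => //.
    - by rewrite unitmxE detE unitrN1.
    - apply: nofix0.
      by apply/rowP => j; rewrite !mxE; case: eqP => // <-.
    - by rewrite detE invrN1 mulrN1; apply: scalar_path_real; rewrite oppr_gt0.
  exact: conjugate_trans c1 (conjugate_trans MP c2).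
Qed.

(** * The classification *)

Theorem theorem1p1 (R : realType) (K : numFieldType)
    (hK : K = (R[i] : numFieldType) \/ K = (R : numFieldType))
    (n : nat) (A C : 'M[K]_n) (b d : 'cV[K]_n)
    (p q : nat) (As : 'M[K]_p) (A0 : 'M[K]_q)
    (r s : nat) (Cs : 'M[K]_r) (C0 : 'M[K]_s)
    (hA : nonsingular_nilpotent_parts A As A0)
    (hC : nonsingular_nilpotent_parts C Cs C0) :
  [/\ (* (1) *)
      has_fixed_point (affine A b) -> has_fixed_point (affine C d) ->
        (topologically_conjugate (affine A b) (affine C d) <->
         topologically_conjugate (fun x : 'cV[K]_n => A *m x)
                                 (fun x : 'cV[K]_n => C *m x)),
      (* (2) *)
      has_fixed_point (affine A b) -> ~ has_fixed_point (affine C d) ->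
        ~ topologically_conjugate (affine A b) (affine C d),
      (* (3a) *)
      K = (R[i] : numFieldType) ->
      ~ has_fixed_point (affine A b) -> ~ has_fixed_point (affine C d) ->
        (topologically_conjugate (affine A b) (affine C d) <->
         similar_mx A0 C0)
    & (* (3b) *)
      K = (R : numFieldType) ->
      ~ has_fixed_point (affine A b) -> ~ has_fixed_point (affine C d) ->
        (topologically_conjugate (affine A b) (affine C d) <->
         0 < \det As * \det Cs /\ similar_mx A0 C0)].
Proof.
have toc (f g : 'cV[K]_n -> 'cV[K]_n) : topologically_conjugate f g <-> conjugate f g.
  by [].
split.
- move=> [x fx] [y gy].
  have cA := conjugate_translation fx; have cC := conjugate_translation gy.
  split=> /toc fg; apply/toc.
    exact: conjugate_trans (conjugate_sym cA) (conjugate_trans fg cC).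
  exact: conjugate_trans cA (conjugate_trans fg (conjugate_sym cC)).
- by move=> fixA fixC /toc fg; apply: fixC; exact: fixed_point_conjugate fg fixA.
- move=> KE; clear hK toc; subst K => fixA fixC.
  have dimC := @injective_dim_complex R.
  have [Asu _ _] := hA; have [Csu _ _] := hC; split=> [fg|sim].
    exact: (conjugate_nilpotent_similar dimC hA hC fg).
  apply: (similar_nilpotent_conjugate (iota := fun t : R => (t%:C)%C)
    (re := fun z => complex.Re z) _ _ _ _ _ hA hC fixA fixC) => //.
  - exact: continuous_real_complex.
  - exact: continuous_Re.
  - by move=> [x y].
  - apply: scalar_path_complex; apply: mulf_neq0.
      by have := Asu; rewrite unitmxE unitfE.
    by rewrite invr_eq0; have := Csu; rewrite unitmxE unitfE.
- move=> KE; clear hK toc; subst K => fixA fixC.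
  have dimR := @injective_dim_real R.
  have [Asu _ _] := hA; have [Csu _ _] := hC; split=> [fg|[det_gt0 sim]].
    split; last exact: (conjugate_nilpotent_similar dimR hA hC fg).
    have [b1 [d1 [fixAs fixCs fgs]]] := conjugate_nonsingular_parts hA hC fixA fixC fg.
    have pr := conjugate_parts_size dimR hA hC fg; clear hA hC; subst r.
    exact: nonsingular_conjugate_same_sign fgs.
  have id_cont : continuous (@id R) by move=> x; exact: cvg_id.
  apply: (similar_nilpotent_conjugate (iota := @id R) (re := @id R)
    _ _ _ _ _ hA hC fixA fixC) => //.
  apply: scalar_path_real.
  have Cs0 : \det Cs != 0 by rewrite -unitfE -unitmxE.
  by rewrite -(pmulr_lgt0 _ (_ : 0 < \det Cs ^+ 2)) ?exprn_even_gt0// expr2 mulrA divfK.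
Qed.
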